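(* Consider $\mathcal{C}=\mathbb{R}^8$ endowed with a norm $n$ either positive definite or of signature $(4,4)$, take $x\in\mathcal{C}$ with $n(x)=1$, and $V=\langle x\rangle^\perp\cong\mathbb{R}^7$. Consider the spin representation of $\mathrm{Spin}(V,-n)$ on $\mathcal{C}$. Then the stabilizer of the unit spinor $x$ is $$\{g\in\mathrm{Spin}(V,-n):g\cdot x=x\}\cong\begin{cases}G_{2,-14}&\text{if $n$ is definite,}\\ G_{2,2}&\text{otherwise,}\end{cases}$$ and hence $$\mathrm{Spin}(7)/G_{2,-14}\cong\mathbb{S}^7,\qquad \mathrm{Spin}(3,4)/G_{2,2}\cong\mathbb{S}^7_4.$$
   Context: The vector space $\mathcal{C}$ is equipped with an octonion algebra structure (an 8-dimensional unital algebra with nondegenerate multiplicative quadratic form $n$, $n(yz)=n(y)n(z)$) with norm $n$ and identity element $x$: the division octonion algebra if $n$ is definite and the split octonion algebra if $n$ has signature $(4,4)$. Thus $V=\langle x\rangle^\perp$ is the space of zero trace octonions. The Clifford algebra $\mathfrak{Cl}(V,-n)$ is the unital associative algebra generated by $V$ subject to $v^2=-n(v)1$, and $\mathrm{Spin}(V,-n)=\{\pm a_1\cdots a_{2r}:a_i\in V,\ \prod_{i=1}^{2r} n(a_i)=1\}\subset\mathfrak{Cl}(V,-n)$, denoted $\mathrm{Spin}(7)$ when $n$ is definite and $\mathrm{Spin}(3,4)$ otherwise. The spin representation on $\mathcal{C}$ is $(\pm a_1\cdots a_{2r})\cdot y=\pm a_1(a_2(\cdots(a_{2r}y)\cdots))$,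 using the octonion product; elements of $\mathcal{C}$ are called spinors. $\mathbb{S}^7$ (definite case) and $\mathbb{S}^7_4$ (signature $(4,4)$) are the sphere and the pseudosphere $\{y\in\mathcal{C}:n(y)=1\}$. $G_{2,-14}$ and $G_{2,2}$ denote the real Lie groups of type $G_2$ given by the stabilizers in $\mathrm{GL}_7(\mathbb{R})$ of the 3-forms, respectively, $\Omega_1=e^{147}+e^{257}+e^{367}+e^{123}-e^{156}+e^{246}-e^{345}$ (where $e^{ijk}=e_i^*\wedge e_j^*\wedge e_k^*$ for a basis $\{e_i^*\}$ of $(\mathbb{R}^7)^*$) and $\Omega_0=-2\sum_{i=1}^3E_0^*\wedge E_i^*\wedge F_i^*-4E_1^*\wedge E_2^*\wedge E_3^*+4F_1^*\wedge F_2^*\wedge F_3^*$ (where $\{E_0^*,E_i^*,F_i^*\}$ is the dual of the canonical basis of $\mathbb{R}^7$). *)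

(* Defs.v *)
From HB Require Import structures.
From mathcomp Require Import all_boot all_order all_algebra all_field.
From mathcomp Require Import all_classical all_reals all_analysis.

Set Implicit Arguments.
Unset Strict Implicit.
Unset Printing Implicit Defensive.

Import Order.TTheory GRing.Theory Num.Theory.
Import numFieldNormedType.Exports.
Local Open Scope classical_set_scope.
Local Open Scope ring_scope.

Section Smooth.
Context {R : realType}.

(* C^oo on the open set O: every iterated directional derivative of F exists
   and is Frechet differentiable at every point of O. *)
Definition Cinfty_on p q (O : set 'rV[R]_p) (F : 'rV[R]_p -> 'rV[R]_q) : Prop :=
  forall (vs : seq 'rV[R]_p) (y : 'rV[R]_p), O y ->
    differentiable (foldr (fun v G z => 'D_v G z) F vs) y.

(* A finite dimensional space carries the topology and the smooth structure of
   R^d through the coordinates in a basis; they do not depend on the basis. *)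
Definition coords (U : vectType R) (u : U) : 'rV[R]_(\dim {:U}) :=
  passmx.rVof (vbasis {:U}) u.

Definition of_coords (U : vectType R) (r : 'rV[R]_(\dim {:U})) : U :=
  passmx.vecof (vbasis {:U}) r.

Definition vopen (U : vectType R) (O : set U) : Prop :=
  open [set r | O (of_coords r)].

(* Smoothness on an arbitrary subset D: local existence of C^oo extensions to
   the ambient space.  When D is an embedded submanifold, such as a closed
   subgroup or a quadric, this is smoothness for its manifold structure. *)
Definition smooth_on (U W : vectType R) (D : set U) (f : U -> W) : Prop :=
  forall p, D p -> exists (O : set U) (F : U -> W),
    [/\ vopen O, O p,
        Cinfty_on [set r | O (of_coords r)] (fun r => coords (F (of_coords r)))
      & forall y, D y -> O y -> f y = F y].

(* Isomorphism of Lie groups, for closed subgroups G and H of the unit groups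
   of finite dimensional associative algebras. *)
Definition lie_group_iso (A B : falgType R) (G : set A) (H : set B) : Prop :=
  exists (f : A -> B) (h : B -> A),
    [/\ set_bij G H f,
        forall a b, G a -> G b -> f (a * b) = f a * f b,
        forall a, G a -> h (f a) = a,
        smooth_on G f
      & smooth_on H h].

Definition lcoset_of (A : falgType R) (g : A) (H : set A) : set A :=
  [set g * h | h in H].

(* G/H and S are isomorphic as homogeneous G-manifolds.  Since G -> G/H is a
   surjective submersion, a map out of G/H is smooth iff its composite with
   G -> G/H is, and a map into G/H is smooth iff it lifts locally to a smooth
   map into G: the last two clauses are the smoothness of Phi and of its
   inverse. *)
Definition homogeneous_diffeo (A : falgType R) (W : vectType R)
    (act : A -> W -> W) (G H : set A) (S : set W) : Prop :=
  exists Phi : set A -> W,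
    [/\ set_bij [set lcoset_of g H | g in G] S Phi,
        forall g k, G g -> G k ->
          Phi (lcoset_of (g * k) H) = act g (Phi (lcoset_of k H)),
        smooth_on G (fun g => Phi (lcoset_of g H))
      & forall p, S p -> exists (O : set W) (sigma : W -> A),
          [/\ vopen O, O p,
              forall q, S q -> O q ->
                G (sigma q) /\ Phi (lcoset_of (sigma q) H) = q
            & smooth_on (S `&` O) sigma]].

End Smooth.

Section QuadraticForms.
Context {R : realType}.

Definition polar (U : lmodType R) (n : U -> R) (y z : U) : R :=
  n (y + z) - n y - n z.

Definition quadratic_form (U : lmodType R) (n : U -> R) : Prop :=
  (forall (a : R) y, n (a *: y) = a ^+ 2 * n y) /\
  bilinear_for *%R *%R (polar n).

Definition nondegenerate (U : lmodType R) (n : U -> R) : Prop :=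
  forall y, (forall z, polar n y z = 0) -> y = 0.

Definition positive_definite (U : lmodType R) (n : U -> R) : Prop :=
  forall y, y != 0 -> 0 < n y.

Definition signature44 (n : 'rV[R]_8 -> R) : Prop :=
  exists2 P : 'M[R]_8, P \in unitmx &
    forall y : 'rV[R]_8,
      n (y *m P) = \sum_(i < 8 | (i < 4)%N) y 0 i ^+ 2
                 - \sum_(i < 8 | (4 <= i)%N) y 0 i ^+ 2.

Definition perp (U : vectType R) (n : U -> R) (x : U) : {vspace U} :=
  lker (linfun (polar n x : U -> R^o)).

Lemma mem_perp (U : vectType R) (n : U -> R) (x v : U) :
  quadratic_form n -> (v \in perp n x) = (polar n x v == 0).
Proof.
case=> _ [_ bil]; have lin : linear (polar n x : U -> R^o).
  by move=> a y z; rewrite bil.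
pose L := GRing.isLinear.Build _ _ _ _ (polar n x : U -> R^o) lin.
pose f : {linear U -> R^o} := HB.pack (polar n x : U -> R^o) L.
by rewrite memv_ker (lfunE f).
Qed.

Definition unit_sphere (U : lmodType R) (n : U -> R) : set U :=
  [set y | n y = 1].

End QuadraticForms.

(* iota : V -> A makes A the unital associative algebra generated by V subject
   to the relations v^2 = q(v)1. *)
Record clifford_algebra (R : realType) (V : lmodType R) (q : V -> R)
    (A : algType R) (iota : {linear V -> A}) : Prop := {
  clifford_sqr : forall v, iota v ^+ 2 = (q v)%:A;
  clifford_ext : forall (B : algType R) (f : {linear V -> B}),
    (forall v, f v ^+ 2 = (q v)%:A) ->
    exists phi : {lrmorphism A -> B}, forall v, phi (iota v) = f v;
  clifford_uniq : forall (B : algType R) (phi psi : {lrmorphism A -> B}),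
    (forall v, phi (iota v) = psi (iota v)) -> phi =1 psi
}.

Record octonion_algebra (R : realType) (n : 'rV[R]_8 -> R) (x : 'rV[R]_8)
    (mul : 'rV[R]_8 -> 'rV[R]_8 -> 'rV[R]_8) : Prop := {
  octonion_norm : quadratic_form n;
  octonion_nondegenerate : nondegenerate n;
  octonion_bilinear : bilinear_for *:%R *:%R mul;
  octonion_mul1l : left_id x mul;
  octonion_mul1r : right_id x mul;
  octonion_normM : forall y z, n (mul y z) = n y * n z
}.

Section Spin.
Context {R : realType} (U : vectType R) (n : U -> R) (x : U).
Context (mul : U -> U -> U).
Context (A : falgType R) (iota : subvs_of (perp n x) -> A).

(* g = (-1)^s a_1 ... a_(2r), with n(a_1) ... n(a_(2r)) = 1. *)
Definition spin_expr (g : A) (s : bool) (a : seq (subvs_of (perp n x))) : Prop :=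
  [/\ ~~ odd (size a), \prod_(v <- a) n (vsval v) = 1
    & g = (-1) ^+ s * \prod_(v <- a) iota v].

Definition Spin : set A := [set g | exists s a, spin_expr g s a].

(* The value at y is (-1)^s a_1(a_2( ... (a_(2r) y))), for any expression of g;
   it is unique when n is the norm of an octonion algebra with product mul and
   identity x, and iota is the Clifford algebra of (perp n x, -n). *)
Definition spin_act (g : A) (y : U) : U :=
  xget 0 [set z | exists s a, spin_expr g s a /\
                    z = (-1) ^+ s *: foldr (fun v => mul (vsval v)) y a].

Definition spin_stabilizer : set A := [set g | Spin g /\ spin_act g x = x].

End Spin.

Section ThreeForms.
Context {R : realType}.

Definition dcoord (i : nat) (u : 'cV[R]_7) : R := u (inord i) 0.

Definition wedge3 (f g h : 'cV[R]_7 -> R) (u v w : 'cV[R]_7) : R :=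
  \det (\matrix_(i < 3, j < 3)
    (tnth [tuple f; g; h] i) (tnth [tuple u; v; w] j)).

Definition Omega1 (u v w : 'cV[R]_7) : R :=
  let e i j k :=
    wedge3 (dcoord i.-1) (dcoord j.-1) (dcoord k.-1) u v w in
  e 1 4 7 + e 2 5 7 + e 3 6 7 + e 1 2 3 - e 1 5 6 + e 2 4 6 - e 3 4 5.

(* Canonical basis of R^7 ordered as E_0, E_1, E_2, E_3, F_1, F_2, F_3. *)
Definition Omega0 (u v w : 'cV[R]_7) : R :=
  let E i := dcoord i in
  let F i := dcoord (3 + i) in
  - 2%:R * (\sum_(1 <= i < 4) wedge3 (E 0) (E i) (F i) u v w)
  - 4%:R * wedge3 (E 1) (E 2) (E 3) u v w
  + 4%:R * wedge3 (F 1) (F 2) (F 3) u v w.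

Definition form_stabilizer (Omega : 'cV[R]_7 -> 'cV[R]_7 -> 'cV[R]_7 -> R) :
    set 'M[R]_7 :=
  [set g | g \in unitmx /\
           forall u v w, Omega (g *m u) (g *m v) (g *m w) = Omega u v w].

Definition G2_compact : set 'M[R]_7 := form_stabilizer Omega1.

Definition G2_split : set 'M[R]_7 := form_stabilizer Omega0.

End ThreeForms.

(* Main.v *)
Require Import Defs.
From HB Require Import structures.
From mathcomp Require Import all_boot all_order all_algebra all_field.
From mathcomp Require Import all_classical all_reals all_analysis.
From mathcomp Require Import ring lra.

Set Implicit Arguments.
Unset Strict Implicit.
Unset Printing Implicit Defensive.

Import Order.TTheory GRing.Theory Num.Theory.
Import numFieldNormedType.Exports.
Local Open Scope classical_set_scope.
Local Open Scope ring_scope.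

(** Every octonion automorphism fixes the unit x, and on the imaginary octonions
    V it preserves the 3-form (yz, w), which in a suitable basis of V is Omega1
    or Omega0.  Conversely a linear map g of V preserving the 3-form preserves n:
    bordering the skew matrix of the contraction of the 3-form with u by the
    covector (u, .) gives a matrix whose determinant is a constant times that of
    left multiplication by u, and the latter has square n(u)^8.  Comparing these
    determinants at u and g u gives n(g u)^2 det(g)^2 = n(u)^2 for generic u, so
    det(g) n(g u) = s n(u) with s = 1 or -1 for all u, and taking Gram
    determinants forces det(g) = s.  So the stabilizers of the two forms are
    automorphism groups of octonion algebras.

    If g = a_1 ... a_2r fixes the spinor x, the identity
    a (v y) = (- s_a v) (a y), with s_a the reflection in a, shows that g acts on
    the octonions as an automorphism.  An automorphism f is, on V, a product of
    reflections, say s_1 ... s_k f = id; then t = a_1 (a_2 ( ... f)) satisfies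
    t (v y) = (-1)^k v (t y), so u = t x associates, up to the sign (-1)^k, with
    all orthogonal imaginary pairs.  This forces k to be even and u to be a real
    multiple of x, hence f comes from an element of the spin group.

    The spin representation is injective on the even Clifford algebra because
    distinct even monomials in an orthogonal basis are separated by traces; this
    gives a linear inverse, so that the isomorphism and its inverse are
    restrictions of affine maps.

    If q is a unit spinor and w is imaginary, orthogonal to q and not null, then
    q = - n(w)^-1 w (w q) is the image of x under - n(w)^-1 w . (w q); taking
    w = (e_a, q) e_b - (e_b, q) e_a gives a rational section of the action
    on the sphere near any point other than x and -x, and these two are first
    moved away by e_1 e_2. *)

(** * Composition identities *)

Section PolarForm.
Context {R : realType} {U : lmodType R} (n : U -> R).
Hypothesis hq : quadratic_form n.

Lemma quadZ a y : n (a *: y) = a ^+ 2 * n y. Proof. exact: hq.1. Qed.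

Lemma quadN y : n (- y) = n y.
Proof. by rewrite -scaleN1r quadZ sqrrN expr1n mul1r. Qed.

Lemma quad0 : n 0 = 0.
Proof. by rewrite -(scale0r 0) quadZ expr0n mul0r. Qed.

Lemma quadD y z : n (y + z) = n y + n z + polar n y z.
Proof. by rewrite /polar; ring. Qed.

Lemma polarC y z : polar n y z = polar n z y.
Proof. by rewrite /polar (addrC y); ring. Qed.

Lemma polar_linl a y y' z :
  polar n (a *: y + y') z = a * polar n y z + polar n y' z.
Proof. by rewrite hq.2.1. Qed.

Lemma polar0l z : polar n 0 z = 0.
Proof. by rewrite /polar add0r quad0; ring. Qed.
Lemma polarDl y y' z : polar n (y + y') z = polar n y z + polar n y' z.
Proof. by rewrite -[y in LHS]scale1r polar_linl mul1r. Qed.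
Lemma polarZl a y z : polar n (a *: y) z = a * polar n y z.
Proof. by rewrite -[a *: y]addr0 polar_linl polar0l addr0. Qed.
Lemma polarNl y z : polar n (- y) z = - polar n y z.
Proof. by rewrite -scaleN1r polarZl mulN1r. Qed.
Lemma polarBl y y' z : polar n (y - y') z = polar n y z - polar n y' z.
Proof. by rewrite polarDl polarNl. Qed.
Lemma polarDr z y y' : polar n z (y + y') = polar n z y + polar n z y'.
Proof. by rewrite polarC polarDl !(polarC z). Qed.
Lemma polarZr a y z : polar n z (a *: y) = a * polar n z y.
Proof. by rewrite polarC polarZl (polarC z). Qed.
Lemma polarNr y z : polar n z (- y) = - polar n z y.
Proof. by rewrite polarC polarNl (polarC z). Qed.
Lemma polarBr z y y' : polar n z (y - y') = polar n z y - polar n z y'.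
Proof. by rewrite polarDr polarNr. Qed.

Lemma polar_self y : polar n y y = 2 * n y.
Proof. by rewrite /polar -mulr2n -scaler_nat quadZ; ring. Qed.

Lemma polar_suml (I : Type) (r : seq I) (P : pred I) (F : I -> U) z :
  polar n (\sum_(i <- r | P i) F i) z = \sum_(i <- r | P i) polar n (F i) z.
Proof.
by elim/big_rec2: _ => [|i a b _ <-]; rewrite ?polar0l// polarDl.
Qed.

Lemma polar_sumr (I : Type) (r : seq I) (P : pred I) (F : I -> U) z :
  polar n z (\sum_(i <- r | P i) F i) = \sum_(i <- r | P i) polar n z (F i).
Proof. by rewrite polarC polar_suml; apply: eq_bigr => i _; rewrite polarC. Qed.

End PolarForm.

Section OctonionIdentities.
Context {R : realType} (n : 'rV[R]_8 -> R) (x : 'rV[R]_8).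
Context (mul : 'rV[R]_8 -> 'rV[R]_8 -> 'rV[R]_8).
Hypothesis hx : n x = 1.
Hypothesis ho : octonion_algebra n x mul.

Let hq : quadratic_form n := octonion_norm ho.
Local Notation "<< y , z >>" := (polar n y z) (at level 0).
Local Infix "**" := mul (at level 40, left associativity).

Lemma polar_inj y y' : (forall z, <<y, z>> = <<y', z>>) -> y = y'.
Proof.
move=> e; apply/eqP; rewrite -subr_eq0; apply/eqP.
by apply: (octonion_nondegenerate ho) => z; rewrite polarBl// e subrr.
Qed.

Lemma omul_linl a y y' z : (a *: y + y') ** z = a *: (y ** z) + y' ** z.
Proof. by rewrite (octonion_bilinear ho).1. Qed.
Lemma omul_linr a y y' z : z ** (a *: y + y') = a *: (z ** y) + z ** y'.
Proof. by rewrite (octonion_bilinear ho).2. Qed.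
Lemma omulDl y y' z : (y + y') ** z = y ** z + y' ** z.
Proof. by rewrite -[y in LHS]scale1r omul_linl scale1r. Qed.
Lemma omulDr y y' z : z ** (y + y') = z ** y + z ** y'.
Proof. by rewrite -[y in LHS]scale1r omul_linr scale1r. Qed.
Lemma omul0l z : 0 ** z = 0.
Proof. by apply: (addrI (0 ** z)); rewrite -omulDl !addr0. Qed.
Lemma omul0r z : z ** 0 = 0.
Proof. by apply: (addrI (z ** 0)); rewrite -omulDr !addr0. Qed.
Lemma omulZl a y z : (a *: y) ** z = a *: (y ** z).
Proof. by rewrite -[a *: y]addr0 omul_linl omul0l addr0. Qed.
Lemma omulZr a y z : z ** (a *: y) = a *: (z ** y).
Proof. by rewrite -[a *: y]addr0 omul_linr omul0r addr0. Qed.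
Lemma omulNl y z : (- y) ** z = - (y ** z).
Proof. by rewrite -scaleN1r omulZl scaleN1r. Qed.
Lemma omulNr y z : z ** (- y) = - (z ** y).
Proof. by rewrite -scaleN1r omulZr scaleN1r. Qed.
Lemma omul1l y : x ** y = y. Proof. exact: (octonion_mul1l ho). Qed.
Lemma omul1r y : y ** x = y. Proof. exact: (octonion_mul1r ho). Qed.
Lemma onormM y z : n (y ** z) = n y * n z.
Proof. exact: (octonion_normM ho). Qed.

Lemma omul_suml (I : Type) (r : seq I) (P : pred I) (F : I -> 'rV[R]_8) z :
  (\sum_(i <- r | P i) F i) ** z = \sum_(i <- r | P i) F i ** z.
Proof. by elim/big_rec2: _ => [|i a b _ <-]; rewrite ?omul0l// omulDl. Qed.
Lemma omul_sumr (I : Type) (r : seq I) (P : pred I) (F : I -> 'rV[R]_8) z :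
  z ** (\sum_(i <- r | P i) F i) = \sum_(i <- r | P i) z ** F i.
Proof. by elim/big_rec2: _ => [|i a b _ <-]; rewrite ?omul0r// omulDr. Qed.

Lemma polar_mull a b c : << a ** b, a ** c >> = n a * <<b, c>>.
Proof. by rewrite /polar -omulDr !onormM; ring. Qed.
Lemma polar_mulr a b c : << a ** c, b ** c >> = <<a, b>> * n c.
Proof. by rewrite /polar -omulDl !onormM; ring. Qed.

(** Multiplicativity of the norm, linearised in both factors: [polar_mull] at [a + c] minus its
    diagonal terms. *)
Lemma polar_exchange a b c d :
  << a ** b, c ** d >> + << c ** b, a ** d >> = <<a, c>> * <<b, d>>.
Proof.
have := polar_mull (a + c) b d.
rewrite !omulDl !(polarDl hq) !(polarDr hq) !polar_mull (quadD n a c); lra.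
Qed.

(** The exchange identity with [x] as third factor; [(x, a) = 0] kills its right-hand side. *)
Lemma omul_skewl a b c : <<x, a>> = 0 -> << a ** b, c >> = - << b, a ** c >>.
Proof.
move=> ha; have := polar_exchange a b x c.
by rewrite !omul1l (polarC n a x) ha mul0r => /eqP; rewrite addr_eq0 => /eqP.
Qed.

Lemma omul_skewr a b c : <<x, a>> = 0 -> << b ** a, c >> = - << b, c ** a >>.
Proof.
move=> ha; have := polar_exchange b a c x.
by rewrite !omul1r (polarC n a x) ha mulr0 (polarC n _ b) => /eqP;
  rewrite addr_eq0 => /eqP.
Qed.

(** Tested against [z], skewness and multiplicativity of the norm give [- n(a) (b, z)];
    nondegeneracy concludes. *)
Lemma omul_sql a b : <<x, a>> = 0 -> a ** (a ** b) = - n a *: b.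
Proof.
move=> ha; apply: polar_inj => z.
by rewrite omul_skewl// polar_mull polarZl// mulNr.
Qed.

Lemma omul_sqr a b : <<x, a>> = 0 -> (b ** a) ** a = - n a *: b.
Proof.
move=> ha; apply: polar_inj => z.
by rewrite omul_skewr// polar_mulr polarZl// mulrC mulNr.
Qed.

(** The Clifford relation for left multiplications: the exchange identity tested against [z], after
    moving the outer factors by skewness. *)
Lemma omul_swapl a b c : <<x, a>> = 0 -> <<x, b>> = 0 ->
  a ** (b ** c) = - <<a, b>> *: c - b ** (a ** c).
Proof.
move=> ha hb; apply: polar_inj => z.
rewrite polarBl// polarZl// (omul_skewl _ z ha) (omul_skewl _ z hb).
by have := polar_exchange a c b z; lra.
Qed.

Lemma omul_anti a b : <<x, a>> = 0 -> <<x, b>> = 0 ->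
  a ** b = - <<a, b>> *: x - b ** a.
Proof. by move=> ha hb; have := omul_swapl x ha hb; rewrite !omul1r. Qed.

Lemma polar_omul_unit a b : <<x, a>> = 0 -> <<x, a ** b>> = - <<a, b>>.
Proof. by move=> ha; rewrite polarC omul_skewl// omul1r (polarC n b). Qed.

End OctonionIdentities.

(** * Adapted bases of the octonions *)

Section Frame.
Context {R : realType} (n : 'rV[R]_8 -> R) (x : 'rV[R]_8).
Context (mul : 'rV[R]_8 -> 'rV[R]_8 -> 'rV[R]_8).
Hypothesis hx : n x = 1.
Hypothesis ho : octonion_algebra n x mul.

Let hq : quadratic_form n := octonion_norm ho.
Local Notation "<< y , z >>" := (polar n y z) (at level 0).
Local Infix "**" := mul (at level 40, left associativity).

(** Generators of a Cayley-Dickson doubling: [u] and [v] generate a quaternion subalgebra, and [w],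
    orthogonal to it, doubles it. The parameter [g] will be 1 in the definite case and -1 in the
    split case. *)
Record cayley_triple (g : R) (u v w : 'rV[R]_8) : Prop := CayleyTriple {
  ct_i : n u = 1; ct_j : n v = 1; ct_l : n w = g;
  ct_xi : <<x, u>> = 0; ct_xj : <<x, v>> = 0; ct_xl : <<x, w>> = 0;
  ct_ij : <<u, v>> = 0; ct_li : <<w, u>> = 0; ct_lj : <<w, v>> = 0;
  ct_lk : <<w, u ** v>> = 0
}.

(** The list holds the seven pure vectors; index 7 falls on the default value [x], so indices 0 to 7
    give an orthogonal system of the whole algebra. *)
Definition frame (u v w : 'rV[R]_8) (a : nat) : 'rV[R]_8 :=
  nth x [:: u; v; u ** v; w ** u; w ** v; w ** (u ** v); w] a.

Definition frame_norm (g : R) (a : nat) : R := nth 1 [:: 1; 1; 1; g; g; g; g] a.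

(* [frame a ** frame b] is [c *: frame d] for the entry [(c, d)] in row [a] and
   column [b]; the index 7 stands for the identity x. *)
Local Notation "c $ d" := (c, d%N) (at level 50).
Definition frame_table (g : R) (a b : nat) : R * nat :=
  nth (0 $ 7) (nth [::]
  [:: [:: -1 $ 7; 1 $ 2; -1 $ 1; 1 $ 6; -1 $ 5; 1 $ 4; -1 $ 3];
      [:: -1 $ 2; -1 $ 7; 1 $ 0; 1 $ 5; 1 $ 6; -1 $ 3; -1 $ 4];
      [:: 1 $ 1; -1 $ 0; -1 $ 7; -1 $ 4; 1 $ 3; 1 $ 6; -1 $ 5];
      [:: -1 $ 6; -1 $ 5; 1 $ 4; -g $ 7; -g $ 2; g $ 1; g $ 0];
      [:: 1 $ 5; -1 $ 6; -1 $ 3; g $ 2; -g $ 7; -g $ 0; g $ 1];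
      [:: -1 $ 4; 1 $ 3; -1 $ 6; -g $ 1; g $ 0; -g $ 7; g $ 2];
      [:: 1 $ 3; 1 $ 4; 1 $ 5; -g $ 0; -g $ 1; -g $ 2; -g $ 7]] a) b.

Section CayleyTriple.
Variables (g : R) (u v w : 'rV[R]_8).
Hypothesis ct : cayley_triple g u v w.
Let ni := ct_i ct. Let nj := ct_j ct. Let nl := ct_l ct.
Let xi := ct_xi ct. Let xj := ct_xj ct. Let xl := ct_xl ct.
Let ij := ct_ij ct. Let li := ct_li ct. Let lj := ct_lj ct.
Let lk := ct_lk ct.
Local Notation e := (frame u v w).

Let sql := omul_sql ho. Let sqr := omul_sqr ho.

Let nk : n (u ** v) = 1. Proof. by rewrite (onormM ho) ni nj mulr1. Qed.
Let xk : <<x, (u ** v)>> = 0. Proof. by rewrite (polar_omul_unit ho)// ij oppr0. Qed.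
Let ik : <<u, (u ** v)>> = 0.
Proof. by rewrite -[in X in <<X, _>>](omul1r ho u) (polar_mull ho) xj mulr0. Qed.
Let jk : <<v, (u ** v)>> = 0.
Proof. by rewrite -[in X in <<X, _>>](omul1l ho v) (polar_mulr ho) xi mul0r. Qed.

Let anti a b : <<x, a>> = 0 -> <<x, b>> = 0 -> <<a, b>> = 0 ->
  a ** b = - (b ** a).
Proof. by move=> ha hb hab; rewrite (omul_anti ho)// hab oppr0 scale0r sub0r. Qed.

Let swap a b c : <<x, a>> = 0 -> <<x, b>> = 0 -> <<a, b>> = 0 ->
  a ** (b ** c) = - (b ** (a ** c)).
Proof. by move=> ha hb hab; rewrite (omul_swapl ho)// hab oppr0 scale0r sub0r. Qed.

Let sq a : <<x, a>> = 0 -> a ** a = - n a *: x.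
Proof. by move=> ha; have := sql x ha; rewrite !(omul1r ho). Qed.

Let h_ji : v ** u = - (u ** v). Proof. by rewrite anti// polarC. Qed.
Let h_ik : u ** (u ** v) = - v. Proof. by rewrite sql// ni scaleN1r. Qed.
Let h_kj : (u ** v) ** v = - u. Proof. by rewrite sqr// nj scaleN1r. Qed.
Let h_ki : (u ** v) ** u = v. Proof. by rewrite anti// ?h_ik ?opprK// polarC. Qed.
Let h_jk : v ** (u ** v) = u. Proof. by rewrite anti// ?h_kj ?opprK. Qed.
Let h_ii : u ** u = - x. Proof. by rewrite sq// ni scaleN1r. Qed.
Let h_jj : v ** v = - x. Proof. by rewrite sq// nj scaleN1r. Qed.
Let h_kk : (u ** v) ** (u ** v) = - x. Proof. by rewrite sq// nk scaleN1r. Qed.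
Let hH := (h_ji, h_ik, h_kj, h_ki, h_jk, h_ii, h_jj, h_kk).

Let lx : <<w, x>> = 0. Proof. by rewrite polarC. Qed.

Let mixed a b : <<x, a>> = 0 -> <<w, b ** a>> = 0 -> <<w ** a, b>> = 0.
Proof. by move=> ha h; rewrite (omul_skewr ho)// h oppr0. Qed.

Let polarNr0 a b : <<a, b>> = 0 -> <<a, - b>> = 0.
Proof. by move=> h; rewrite polarNr// h oppr0. Qed.

(** Left multiplication by [w] is a similarity, which settles pairs in the same half of the
    doubling; for a mixed pair, skewness reduces to [w] against a quaternion. *)
Lemma frame_gram a b : (a < 8)%N -> (b < 8)%N ->
  <<e a, e b>> = if a == b then 2 * frame_norm g a else 0.
Proof.
wlog: a b / (a <= b)%N => [H|].
  case: (leqP a b) => [/H //|ba a8 b8].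
  by rewrite polarC H ?(ltnW ba)// eq_sym; case: eqP => // ->.
have ll a' b' : <<a', b'>> = 0 -> <<w ** a', w ** b'>> = 0.
  by move=> h; rewrite (polar_mull ho) h mulr0.
have l1 a' : <<x, a'>> = 0 -> <<w ** a', w>> = 0.
  by move=> h; rewrite -[in X in <<_, X>>](omul1r ho w) ll// polarC.
have m a' b' : <<x, a'>> = 0 -> <<w, b' ** a'>> = 0 -> <<b', w ** a'>> = 0.
  by move=> h1 h2; rewrite polarC mixed.
case: a => [|[|[|[|[|[|[|[|//]]]]]]]]; case: b => [|[|[|[|[|[|[|[|//]]]]]]]] //= _ _ _;
 rewrite /frame/frame_norm/= ?(polar_self hq) ?(onormM ho) ?ni ?nj ?nl ?hx ?mulr1 //.
all: try by [|rewrite polarC].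
all: try by [apply: ll | apply: l1].
all: try by apply: m => //; rewrite ?hH ?polarNr0.
all: by rewrite polarC (polar_omul_unit ho)// ?li ?lj ?lk oppr0.
Qed.

(** The Cayley-Dickson rules: for the pure quaternions [a], [b] of the frame, [w(wa) = - g a],
    [a(wb) = - w(ab)], [(wa)b = w(ba)] and [(wa)(wb) = g ba]. They come from exchanging orthogonal
    pure factors. *)
Lemma frame_mul a b : (a < 7)%N -> (b < 7)%N ->
  e a ** e b = (frame_table g a b).1 *: e (frame_table g a b).2.
Proof.
have pl a' : <<x, a'>> = 0 -> <<w, a'>> = 0 -> <<x, w ** a'>> = 0.
  by move=> h h'; rewrite (polar_omul_unit ho)// h' oppr0.
have LL a' : w ** (w ** a') = - g *: a' by rewrite sql// nl.
have IL a' b' : <<x, a'>> = 0 -> <<w, a'>> = 0 ->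
    a' ** (w ** b') = - (w ** (a' ** b')).
  by move=> h h'; rewrite swap// polarC.
have LI a' b' : <<x, a'>> = 0 -> <<x, b'>> = 0 -> <<w, a'>> = 0 ->
    <<w, b'>> = 0 -> <<w, a' ** b'>> = 0 -> (w ** a') ** b' = w ** (b' ** a').
  move=> h1 h2 h3 h4 h5; rewrite anti// ?IL ?opprK//; first exact: pl.
  rewrite mixed// (omul_anti ho)// polarBr// polarZr// lx h5; ring.
have LLm a' b' : <<x, a'>> = 0 -> <<x, b'>> = 0 -> <<w, a'>> = 0 ->
    <<w, b'>> = 0 -> <<w, a' ** b'>> = 0 ->
    (w ** a') ** (w ** b') = g *: (b' ** a').
  move=> h1 h2 h3 h4 h5; rewrite swap ?LI ?LL ?scaleNr ?opprK//; first exact: pl.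
  by rewrite -[in X in <<_, X>>](omul1r ho w) (polar_mull ho) polarC h1 mulr0.
have IL0 a' : <<x, a'>> = 0 -> <<w, a'>> = 0 -> a' ** w = - (w ** a').
  by move=> h h'; rewrite anti// polarC.
have LIL a' : <<x, a'>> = 0 -> <<w, a'>> = 0 -> (w ** a') ** w = g *: a'.
  move=> h h'; rewrite anti ?LL ?scaleNr ?opprK//; first exact: pl.
  by rewrite -[in X in <<_, X>>](omul1r ho w) (polar_mull ho) polarC h mulr0.
have sl : w ** w = - g *: x by rewrite sq ?nl.
have IL1 a' b' c : <<x, a'>> = 0 -> <<w, a'>> = 0 -> a' ** b' = c ->
    a' ** (w ** b') = - (w ** c).
  by move=> h h' <-; exact: IL.
have LI1 a' b' c : <<x, a'>> = 0 -> <<x, b'>> = 0 -> <<w, a'>> = 0 ->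
    <<w, b'>> = 0 -> <<w, a' ** b'>> = 0 -> b' ** a' = c ->
    (w ** a') ** b' = w ** c.
  by move=> h1 h2 h3 h4 h5 <-; exact: LI.
have LLm1 a' b' c : <<x, a'>> = 0 -> <<x, b'>> = 0 -> <<w, a'>> = 0 ->
    <<w, b'>> = 0 -> <<w, a' ** b'>> = 0 -> b' ** a' = c ->
    (w ** a') ** (w ** b') = g *: c.
  by move=> h1 h2 h3 h4 h5 <-; exact: LLm.
have wN y : w ** - y = - (w ** y) by rewrite (omulNr ho).
have hl a' b' c : a' ** b' = c -> <<w, c>> = 0 -> <<w, a' ** b'>> = 0.
  by move=> ->.
have wx : <<w, - x>> = 0 by rewrite polarNr0.
have wu : <<w, - u>> = 0 by rewrite polarNr0.
have wv : <<w, - v>> = 0 by rewrite polarNr0.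
have wk : <<w, - (u ** v)>> = 0 by rewrite polarNr0.
have IL_ := (IL1 _ _ _ xi li h_ii,
  IL1 _ _ _ xi li (erefl (u ** v)),
  IL1 _ _ _ xi li h_ik,
  IL1 _ _ _ xj lj h_ji,
  IL1 _ _ _ xj lj h_jj,
  IL1 _ _ _ xj lj h_jk,
  IL1 _ _ _ xk lk h_ki,
  IL1 _ _ _ xk lk h_kj,
  IL1 _ _ _ xk lk h_kk).
have LI_ := (LI1 _ _ _ xi xi li li (hl _ _ _ h_ii wx) h_ii,
  LI1 _ _ _ xi xj li lj (hl _ _ _ (erefl (u ** v)) lk) h_ji,
  LI1 _ _ _ xi xk li lk (hl _ _ _ h_ik wv) h_ki,
  LI1 _ _ _ xj xi lj li (hl _ _ _ h_ji wk) (erefl (u ** v)),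
  LI1 _ _ _ xj xj lj lj (hl _ _ _ h_jj wx) h_jj,
  LI1 _ _ _ xj xk lj lk (hl _ _ _ h_jk li) h_kj,
  LI1 _ _ _ xk xi lk li (hl _ _ _ h_ki lj) h_ik,
  LI1 _ _ _ xk xj lk lj (hl _ _ _ h_kj wu) h_jk,
  LI1 _ _ _ xk xk lk lk (hl _ _ _ h_kk wx) h_kk).
have LL_ := (LLm1 _ _ _ xi xi li li (hl _ _ _ h_ii wx) h_ii,
  LLm1 _ _ _ xi xj li lj (hl _ _ _ (erefl (u ** v)) lk) h_ji,
  LLm1 _ _ _ xi xk li lk (hl _ _ _ h_ik wv) h_ki,
  LLm1 _ _ _ xj xi lj li (hl _ _ _ h_ji wk) (erefl (u ** v)),
  LLm1 _ _ _ xj xj lj lj (hl _ _ _ h_jj wx) h_jj,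
  LLm1 _ _ _ xj xk lj lk (hl _ _ _ h_jk li) h_kj,
  LLm1 _ _ _ xk xi lk li (hl _ _ _ h_ki lj) h_ik,
  LLm1 _ _ _ xk xj lk lj (hl _ _ _ h_kj wu) h_jk,
  LLm1 _ _ _ xk xk lk lk (hl _ _ _ h_kk wx) h_kk).
have l_ := (IL0 _ xi li, IL0 _ xj lj, IL0 _ xk lk, LIL _ xi li, LIL _ xj lj,
  LIL _ xk lk, LL u, LL v, LL (u ** v), sl).
case: a => [|[|[|[|[|[|[|//]]]]]]] _; case: b => [|[|[|[|[|[|[|//]]]]]]] _;
  rewrite /frame /frame_table /= ?LL_ ?LI_ ?IL_ ?l_ ?hH ?wN ?(omul1r ho) ?opprK;
  by rewrite ?scaleN1r ?scale1r ?scalerN ?scaleNr.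
Qed.

End CayleyTriple.
End Frame.

(** * Three-forms in coordinates *)

Section ThreeForms.
Context {R : realType}.

Lemma det_mx33 (M : 'M[R]_3) :
  \det M = M 0 0 * (M 1 1 * M 2 2 - M 1 2 * M 2 1)
         - M 0 1 * (M 1 0 * M 2 2 - M 1 2 * M 2 0)
         + M 0 2 * (M 1 0 * M 2 1 - M 1 1 * M 2 0).
Proof.
rewrite (expand_det_row _ 0) !big_ord_recl big_ord0.
rewrite /cofactor !(expand_det_row _ 0) !big_ord_recl !big_ord0 /cofactor !det_mx11.
rewrite !mxE /=.
pose f (a b : nat) := M (inord a) (inord b).
have fE (a b : 'I_3) : M a b = f a b by rewrite /f !inord_val.
rewrite !fE /= /bump /=; ring.
Qed.

Lemma wedge3E (f g h : 'cV[R]_7 -> R) u v w :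
  wedge3 f g h u v w =
  f u * (g v * h w - g w * h v) - f v * (g u * h w - g w * h u)
  + f w * (g u * h v - g v * h u).
Proof. by rewrite /wedge3 det_mx33 !mxE /= !(tnth_nth f) !(tnth_nth u). Qed.

End ThreeForms.

Section FrameForm.
Context {R : realType} (g : R) (U V W : nat -> R).

Definition minor3 (a b c : nat) : R :=
  U a * (V b * W c - V c * W b) - V a * (U b * W c - U c * W b)
  + W a * (U b * V c - U c * V b).

(** The 3-form [(UV, W) / 2] in frame coordinates; at [g = 1] it is [Omega1] with all indices
    lowered by one. *)
Definition frame_form : R :=
  minor3 0 1 2 + g * (minor3 0 3 6 + minor3 1 4 6 + minor3 2 5 6
                      - minor3 0 4 5 + minor3 1 3 5 - minor3 2 3 4).

End FrameForm.

Section FrameCoordinates.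
Context {R : realType} (n : 'rV[R]_8 -> R) (x : 'rV[R]_8).
Context (mul : 'rV[R]_8 -> 'rV[R]_8 -> 'rV[R]_8).
Hypothesis hx : n x = 1.
Hypothesis ho : octonion_algebra n x mul.
Variables (g : R) (i j l : 'rV[R]_8).
Hypothesis ct : cayley_triple n x mul g i j l.

Let hq : quadratic_form n := octonion_norm ho.
Local Notation "<< y , z >>" := (polar n y z) (at level 0).
Local Infix "**" := mul (at level 40, left associativity).
Local Notation e := (frame x mul i j l).

Definition frame_comb (U : nat -> R) : 'rV[R]_8 := \sum_(a < 7) U a *: e a.

Lemma polar_frame_comb a (U : nat -> R) : (a < 8)%N ->
  << e a, frame_comb U >> = if (a < 7)%N then 2 * frame_norm g a * U a else 0.
Proof.
move=> a8; rewrite /frame_comb (polar_sumr hq).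
under eq_bigr => b _ do
  rewrite (polarZr hq) (frame_gram hx ho ct a8 (leqW (ltn_ord b))).
case: ifP => a7.
  rewrite (bigD1 (Ordinal a7))//= eqxx mulrC big1 ?addr0// => b.
  by rewrite -val_eqE /= eq_sym => /negPf ->; rewrite mulr0.
rewrite big1// => b _; case: eqP => [ab|]; last by rewrite mulr0.
by move: a7; rewrite ab ltn_ord.
Qed.

Lemma polar_mul_frame_comb U V W :
  << frame_comb U ** frame_comb V, frame_comb W >> = 2 * frame_form g U V W.
Proof.
rewrite {1 2}/frame_comb (omul_suml ho) (polar_suml hq).
under eq_bigr => a _.
  rewrite (omulZl ho) (omul_sumr ho) (polarZl hq) (polar_suml hq).
  under eq_bigr => b _.
    rewrite (omulZr ho) (polarZl hq) (frame_mul ho ct)// (polarZl hq).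
    rewrite polar_frame_comb; last first.
      case: a b => [[|[|[|[|[|[|[|//]]]]]]] _] [[|[|[|[|[|[|[|//]]]]]]] _] //=.
    over.
  over.
rewrite /frame_form /minor3 !big_ord_recl !big_ord0 /frame_table /frame_norm /=.
ring.
Qed.

End FrameCoordinates.

(** * Gram matrices and orthogonal vectors *)

Section GramMatrix.
Context {R : realType} {m : nat} (n : 'rV[R]_m -> R).
Hypothesis hq : quadratic_form n.

Definition gram : 'M[R]_m :=
  \matrix_(i, j) polar n (delta_mx 0 i) (delta_mx 0 j).

Lemma gramE y z : (y *m gram *m z^T) 0 0 = polar n y z.
Proof.
rewrite [y in RHS]row_sum_delta [z in RHS]row_sum_delta (polar_sumr hq) mxE.
apply: eq_bigr => j _; rewrite (polarZr hq) (polar_suml hq) !mxE mulrC.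
by congr (_ * _); apply: eq_bigr => i _; rewrite (polarZl hq) mxE.
Qed.

Lemma gram_mulE p q (A : 'M[R]_(p, m)) (B : 'M[R]_(q, m)) :
  A *m gram *m B^T = \matrix_(i, j) polar n (row i A) (row j B).
Proof.
apply/matrixP => i j; rewrite [RHS]mxE -gramE tr_row -row_mul !mxE.
by apply: eq_bigr => k _; rewrite !mxE.
Qed.

(** The conditions are [size s] linear equations in the [p] coefficients of [w], so a nonzero
    solution exists. Taking coefficients along the rows of [P] confines the search to a chosen
    subspace. *)
Lemma exists_orthogonal p (P : 'M[R]_(p, m)) (s : seq 'rV[R]_m) :
  (size s < p)%N -> exists2 w : 'rV[R]_p, w != 0 &
    forall y, y \in s -> polar n y (w *m P) = 0.
Proof.
move=> sp; pose K := P *m gram *m (\matrix_(j < size s) s`_j)^T.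
have : (kermx K != 0)%MS.
  rewrite -mxrank_eq0 mxrank_ker -lt0n subn_gt0.
  exact: leq_ltn_trans (rank_leq_col _) sp.
case/rowV0Pn => w /sub_kermxP wK w0; exists w => // y ys.
have ys' : (index y s < size s)%N by rewrite index_mem.
move/rowP: wK => /(_ (Ordinal ys')); rewrite /K !mulmxA gram_mulE !mxE polarC.
by rewrite row_id rowK /= nth_index.
Qed.

End GramMatrix.

(** * Existence of Cayley triples *)

Section FrameBasis.
Context {R : realType} (n : 'rV[R]_8 -> R) (x : 'rV[R]_8).
Context (mul : 'rV[R]_8 -> 'rV[R]_8 -> 'rV[R]_8).
Hypothesis hx : n x = 1.
Hypothesis ho : octonion_algebra n x mul.

Let hq : quadratic_form n := octonion_norm ho.
Local Notation "<< y , z >>" := (polar n y z) (at level 0).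
Local Infix "**" := mul (at level 40, left associativity).

Lemma frame_norm_neq0 (g : R) a : g != 0 -> frame_norm g a != 0.
Proof.
move=> g0; rewrite /frame_norm.
by case: a => [|[|[|[|[|[|[|a]]]]]]] //=; rewrite ?nth_nil ?oner_neq0.
Qed.

(** The Gram matrix of the eight frame vectors is diagonal with nonzero entries, so they form a
    basis; pairing with [x], the last of them, kills its coefficient. *)
Lemma frame_comb_surj (g : R) i j l v : cayley_triple n x mul g i j l ->
  g != 0 -> <<x, v>> = 0 -> exists U, v = frame_comb x mul i j l U.
Proof.
move=> ct g0 xv; pose Q := \matrix_(a < 8) frame x mul i j l a.
have QG : Q *m gram n *m Q^T = diag_mx (\row_(a < 8) (2 * frame_norm g a)).
  apply/matrixP => a b; rewrite gram_mulE// !mxE !rowK (frame_gram hx ho ct)//.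
  by rewrite -val_eqE; case: eqP => [|_]; rewrite ?mulr1n ?mulr0n.
have Qu : Q \in unitmx.
  have : \det (Q *m gram n *m Q^T) != 0.
    rewrite QG det_diag; apply/prodf_neq0 => a _.
    by rewrite mxE mulf_neq0 ?pnatr_eq0 ?frame_norm_neq0.
  rewrite !det_mulmx mulf_eq0 negb_or mulf_eq0 negb_or unitmxE unitfE.
  by case/andP => /andP[].
pose c := v *m invmx Q.
have vE : v = \sum_(a < 8) c 0 a *: frame x mul i j l a.
  rewrite -[LHS](mulmxKV Qu) mulmx_sum_row.
  by apply: eq_bigr => a _; rewrite rowK.
have c7 : c 0 ord_max = 0.
  have := xv; rewrite vE (polar_sumr hq) (bigD1 ord_max)//= big1 ?addr0 => [|a a7].
    rewrite (polarZr hq) -[x in <<x, _>>]/(frame x mul i j l 7).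
    rewrite (frame_gram hx ho ct)//= /frame_norm/= => /eqP.
    by rewrite mulr1 mulf_eq0 pnatr_eq0 orbF => /eqP.
  rewrite (polarZr hq) -[x in <<x, _>>]/(frame x mul i j l 7).
  rewrite (frame_gram hx ho ct)//= eq_sym -[7%N]/(val (@ord_max 7)) val_eqE.
  by rewrite (negPf a7) mulr0.
exists (fun a => c 0 (inord a)); rewrite vE big_ord_recr /= c7 scale0r addr0.
by apply: eq_bigr => a _; congr (c 0 _ *: _); apply: val_inj; rewrite /= inordK// leqW.
Qed.

Lemma normalize_pos y : 0 < n y -> exists2 a, a != 0 & n (a *: y) = 1.
Proof.
move=> y0; exists (Num.sqrt (n y))^-1; first by rewrite invr_eq0 sqrtr_eq0 -ltNge.
by rewrite (quadZ hq) exprVn sqr_sqrtr ?ltW// mulVf// gt_eqF.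
Qed.

Lemma normalize_neg y : n y < 0 -> exists2 a, a != 0 & n (a *: y) = -1.
Proof.
move=> y0; have y1 : 0 < - n y by rewrite oppr_gt0.
exists (Num.sqrt (- n y))^-1; first by rewrite invr_eq0 sqrtr_eq0 -ltNge.
by rewrite (quadZ hq) exprVn sqr_sqrtr ?ltW// invrN mulNr mulVf// lt_eqF.
Qed.

(** At most four orthogonality conditions are imposed in dimension 8, and every nonzero vector can
    be scaled to norm 1. *)
Lemma cayley_triple_definite :
  positive_definite n -> exists i j l, cayley_triple n x mul 1 i j l.
Proof.
move=> pd; have orth (s : seq 'rV[R]_8) : (size s < 8)%N ->
    exists2 y, n y = 1 & forall z, z \in s -> <<y, z>> = 0.
  move=> /(exists_orthogonal hq 1%:M)[w w0 ws].
  have [a _ na] := normalize_pos (pd _ w0).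
  exists (a *: w) => // z /ws; rewrite mulmx1 polarC (polarZl hq) => ->.
  by rewrite mulr0.
have [//|i ni si] := orth [:: x].
have [//|j nj sj] := orth [:: x; i].
have [//|l nl sl] := orth [:: x; i; j; i ** j].
exists i, j, l; split => //; rewrite ?(polarC n x) ?(polarC n i j) ?si ?sj ?sl//.
all: by rewrite !inE eqxx ?orbT.
Qed.

(** A positive definite subspace of dimension 4 leaves room for [i] and [j] of norm 1. The
    quaternion subalgebra they generate is positive definite, so projecting a vector of norm -1 off
    it keeps the norm negative; rescaling gives [l]. *)
Lemma cayley_triple_split :
  signature44 n -> exists i j l, cayley_triple n x mul (-1) i j l.
Proof.
case=> P Pu nP; pose p : 'M[R]_(4, 8) := pid_mx 4 *m P.
have npos w : w != 0 -> 0 < n (w *m p).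
  move=> w0; rewrite mulmxA nP.
  have wE (a : 'I_8) : (w *m (pid_mx 4 : 'M[R]_(4, 8))) 0 a =
      if (a < 4)%N then w 0 (inord a) else 0.
    rewrite mxE; case: ifP => a4.
      rewrite (bigD1 (inord a))//= big1 ?addr0 => [|b ba].
        by rewrite mxE inordK// eqxx a4 mulr1.
      rewrite mxE; case: eqP => //= [ba'|]; last by rewrite mulr0.
      by rewrite -ba' inord_val eqxx in ba.
    rewrite big1// => b _; rewrite mxE; case: eqP => //= [ba|]; last by rewrite mulr0.
    by rewrite -ba ltn_ord in a4.
  rewrite [X in _ - X]big1 ?subr0 => [|a a4]; last by rewrite wE ltnNge a4 expr0n.
  have /rV0Pn[a wa] := w0; pose a' : 'I_8 := widen_ord (isT : (4 <= 8)%N) a.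
  rewrite (bigD1 a') ?ltn_ord//= ltr_pwDl//; last first.
    by apply: sumr_ge0 => b _; exact: sqr_ge0.
  by rewrite wE /= ltn_ord inord_val lt_def sqrf_eq0 wa sqr_ge0.
have orth (s : seq 'rV[R]_8) : (size s < 4)%N ->
    exists2 y, n y = 1 & forall z, z \in s -> <<y, z>> = 0.
  move=> /(exists_orthogonal hq p)[w w0 ws].
  have [a _ na] := normalize_pos (npos _ w0).
  exists (a *: (w *m p)) => // z /ws; rewrite polarC (polarZl hq) => ->.
  by rewrite mulr0.
have [//|i ni si] := orth [:: x].
have [//|j nj sj] := orth [:: x; i].
have {}si : <<x, i>> = 0 by rewrite polarC si// mem_head.
have xj : <<x, j>> = 0 by rewrite polarC sj// mem_head.
have ij : <<i, j>> = 0 by rewrite polarC sj// !inE eqxx orbT.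
pose k := i ** j; pose f : 'rV[R]_8 := delta_mx 0 (inord 4) *m P.
have nf : n f = -1.
  rewrite nP big1 ?add0r => [|a a4]; last first.
    rewrite mxE /=; case: eqP => [aE|_]; last by rewrite expr0n.
    by rewrite aE inordK in a4.
  congr (- _); rewrite (bigD1 (inord 4))/= ?inordK// mxE !eqxx expr1n big1 ?addr0//.
  by move=> a /andP[_ /negPf a4]; rewrite mxE a4 expr0n.
have nk : n k = 1 by rewrite (onormM ho) ni nj mulr1.
have xk : <<x, k>> = 0 by rewrite (polar_omul_unit ho)// ij oppr0.
have ik : <<i, k>> = 0.
  by rewrite -[in X in <<X, _>>](omul1r ho i) (polar_mull ho) xj mulr0.
have jk : <<j, k>> = 0.
  by rewrite -[in X in <<X, _>>](omul1l ho j) (polar_mulr ho) si mul0r.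
(* Division by 2 because [polar n y y = 2] when [n y = 1]. *)
pose c y := <<f, y>> / 2.
pose h := f - c x *: x - c i *: i - c j *: j - c k *: k.
have self y : n y = 1 -> <<y, y>> = 2 by rewrite (polar_self hq) => ->; rewrite mulr1.
have hE y : <<h, y>> = <<f, y>> - c x * <<x, y>> - c i * <<i, y>>
    - c j * <<j, y>> - c k * <<k, y>>.
  by rewrite !(polarBl hq) !(polarZl hq).
have sym y z : <<y, z>> = 0 -> <<z, y>> = 0 by rewrite polarC.
have hx0 : <<h, x>> = 0.
  by rewrite hE (self x)// (sym _ _ si) (sym _ _ xj) (sym _ _ xk) /c; lra.
have hi0 : <<h, i>> = 0 by rewrite hE (self i)// si (sym _ _ ij) (sym _ _ ik) /c; lra.
have hj0 : <<h, j>> = 0 by rewrite hE (self j)// xj ij (sym _ _ jk) /c; lra.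
have hk0 : <<h, k>> = 0 by rewrite hE (self k)// xk ik jk /c; lra.
(* In fact [n(h) = - 1 - c(x)^2 - c(i)^2 - c(j)^2 - c(k)^2]. *)
have nh : n h < 0.
  have : <<h, h>> = <<h, f>>.
    by rewrite {2}/h !(polarBr hq) !(polarZr hq) hx0 hi0 hj0 hk0; lra.
  rewrite (polar_self hq) hE (polar_self hq) nf !(polarC n _ f).
  have := sqr_ge0 (c x); have := sqr_ge0 (c i).
  have := sqr_ge0 (c j); have := sqr_ge0 (c k); rewrite /c; nra.
have [a a0 na] := normalize_neg nh.
exists i, j, (a *: h); split => //.
all: by rewrite ?(polarC n x) (polarZl hq) ?hx0 ?hi0 ?hj0 ?hk0 mulr0.
Qed.

End FrameBasis.

(** * Bases of the pure octonions adapted to the two 3-forms *)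

Section AdaptedFrame.
Context {R : realType} (n : 'rV[R]_8 -> R) (x : 'rV[R]_8).
Context (mul : 'rV[R]_8 -> 'rV[R]_8 -> 'rV[R]_8).
Hypothesis hx : n x = 1.
Hypothesis ho : octonion_algebra n x mul.

Let hq : quadratic_form n := octonion_norm ho.
Local Notation "<< y , z >>" := (polar n y z) (at level 0).
Local Infix "**" := mul (at level 40, left associativity).

(** Coordinates are columns, as in [form_stabilizer], whereas octonions are rows; hence the
    transposes. The factor 2 comes from [polar n y y = 2 * n y]. *)
Record adapted_frame (Omega : 'cV[R]_7 -> 'cV[R]_7 -> 'cV[R]_7 -> R)
    (P : 'M[R]_(7, 8)) : Prop := {
  adapted_perp : forall u : 'cV_7, <<x, u^T *m P>> = 0;
  adapted_span : forall v, <<x, v>> = 0 -> exists u : 'cV_7, v = u^T *m P;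
  adapted_form : forall u v w : 'cV_7,
    <<(u^T *m P) ** (v^T *m P), w^T *m P>> = 2 * Omega u v w
}.

(** Here [f] turns coordinates along [P] into frame coordinates and [h] is a right inverse of it, so
    each case reduces to a polynomial identity between [frame_form] and [Omega]. *)
Lemma adapted_frame_of (g : R) i j l Omega P
    (f : 'cV[R]_7 -> nat -> R) (h : (nat -> R) -> 'cV[R]_7) :
  cayley_triple n x mul g i j l -> g != 0 ->
  (forall u : 'cV_7, u^T *m P = frame_comb x mul i j l (f u)) ->
  (forall U a, (a < 7)%N -> f (h U) a = U a) ->
  (forall u v w, frame_form g (f u) (f v) (f w) = Omega u v w) ->
  adapted_frame Omega P.
Proof.
move=> ct g0 fE hK ff; split=> [u|v xv|u v w].
- by rewrite fE -[x in <<x, _>>]/(frame x mul i j l 7) (polar_frame_comb hx ho ct).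
- have [U ->] := frame_comb_surj hx ho ct g0 xv.
  exists (h U); rewrite fE; apply: eq_bigr => a _.
  by rewrite hK.
- by rewrite !fE (polar_mul_frame_comb hx ho ct) ff.
Qed.

Lemma adapted_frame_definite : positive_definite n ->
  exists P, adapted_frame Omega1 P.
Proof.
move=> /(cayley_triple_definite ho)[i [j [l ct]]].
exists (\matrix_(a < 7) frame x mul i j l a).
apply: (@adapted_frame_of 1 i j l _ _ (fun u a => u (inord a) 0)
          (fun U => \col_a U a)) => //.
- move=> u; rewrite mulmx_sum_row; apply: eq_bigr => a _.
  by rewrite rowK mxE inord_val.
- by move=> U a a7; rewrite mxE inordK.
- move=> u v w; rewrite /Omega1 /frame_form !wedge3E /minor3 /dcoord /=; ring.
Qed.

(* The basis E_0 = l, E_a = - (e_a + l e_a), F_a = e_a - l e_a, where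
   e_1, e_2, e_3 = i, j, ij. *)
Lemma adapted_frame_split : signature44 n -> exists P, adapted_frame Omega0 P.
Proof.
move=> /(cayley_triple_split hx ho)[i [j [l ct]]].
pose e := frame x mul i j l.
exists (\matrix_(a < 7) nth 0 [:: e 6; - (e 0 + e 3); - (e 1 + e 4); - (e 2 + e 5);
  e 0 - e 3; e 1 - e 4; e 2 - e 5] a).
(* Obtained by collecting the coefficients of [e 0] to [e 6]; [h] below solves these equations for
   [u]. *)
pose f (u : 'cV[R]_7) (a : nat) : R := let c b := dcoord b u in
  nth 0 [:: c 4 - c 1; c 5 - c 2; c 6 - c 3;
    - c 1 - c 4; - c 2 - c 5; - c 3 - c 6; c 0] a.
pose h (U : nat -> R) : 'cV[R]_7 := \col_a nth 0 [:: U 6;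
  - (U 0 + U 3) / 2; - (U 1 + U 4) / 2; - (U 2 + U 5) / 2;
  (U 0 - U 3) / 2; (U 1 - U 4) / 2; (U 2 - U 5) / 2] a.
apply: (@adapted_frame_of (-1) i j l _ _ f h) => //.
- move=> u; rewrite mulmx_sum_row.
  under eq_bigr => a _ do rewrite rowK mxE -[a in u a]inord_val.
  rewrite /frame_comb !big_ord_recl !big_ord0 /= /f /dcoord /= /bump /=.
  by apply/rowP => b; rewrite !mxE /e; ring.
- move=> U [|[|[|[|[|[|[|//]]]]]]] _; rewrite /f /h /dcoord /= !mxE !inordK//=; lra.
- move=> u v w; rewrite /Omega0 /frame_form /minor3 /f /=.
  rewrite (_ : index_iota 1 4 = [:: 1; 2; 3]%N)//.
  rewrite !big_cons big_nil !wedge3E /dcoord /=; ring.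
Qed.

End AdaptedFrame.

(** * Products of reflections and the Clifford action *)

Section CliffordAction.
Context {R : realType} (n : 'rV[R]_8 -> R) (x : 'rV[R]_8).
Context (mul : 'rV[R]_8 -> 'rV[R]_8 -> 'rV[R]_8).
Hypothesis hx : n x = 1.
Hypothesis ho : octonion_algebra n x mul.

Let hq : quadratic_form n := octonion_norm ho.
Local Notation "<< y , z >>" := (polar n y z) (at level 0).
Local Infix "**" := mul (at level 40, left associativity).
Local Notation oact s y := (foldr mul y s).

Definition pure_nonnull (a : 'rV[R]_8) : bool := (<<x, a>> == 0) && (n a != 0).

(** The orthogonal reflection; the usual factor 2 is already contained in [polar]. *)
Definition reflection (a v : 'rV[R]_8) : 'rV[R]_8 := v - (<<a, v>> / n a) *: a.

Lemma reflection_polar a v w : n a != 0 ->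
  <<reflection a v, reflection a w>> = <<v, w>>.
Proof.
move=> a0; rewrite /reflection !(polarBl hq, polarBr hq, polarZl hq, polarZr hq).
by rewrite (polar_self hq) (polarC n v a); field.
Qed.

Lemma reflection_orthogonal a v : <<a, v>> = 0 -> reflection a v = v.
Proof. by move=> h; rewrite /reflection h mul0r scale0r subr0. Qed.

(** If [n v = n w] then [(w - v, w) = n(w - v)], so the coefficient of [w - v] is 1. *)
Lemma reflection_sub v w : n v = n w -> n (w - v) != 0 -> reflection (w - v) w = v.
Proof.
move=> vw wv; rewrite /reflection.
have -> : <<w - v, w>> / n (w - v) = 1.
  have E : n (w - v) = <<w - v, w>>.
    rewrite (quadD n w (- v)) (quadN hq) (polarNr hq) (polarBl hq) (polar_self hq).
    by rewrite vw (polarC n v); ring.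
  by rewrite -E divff.
by rewrite scale1r opprB addrC subrK.
Qed.

Lemma reflection_add v w : n v = n w -> n (w + v) != 0 ->
  reflection (w + v) w = - v.
Proof.
by move=> vw wv; rewrite -{1}[v]opprK reflection_sub ?(quadN hq) ?opprK.
Qed.

Lemma reflection_self v : n v != 0 -> reflection v (- v) = v.
Proof.
move=> v0; rewrite /reflection (polarNr hq) (polar_self hq) mulNr mulfK//.
by apply/rowP => i; rewrite !mxE; ring.
Qed.

Lemma reflections_pure s v : all pure_nonnull s -> <<x, v>> = 0 ->
  <<x, foldr reflection v s>> = 0.
Proof.
move=> + xv; elim: s => //= a s IH /andP[/andP[/eqP xa _] /IH h].
by rewrite /reflection (polarBr hq) (polarZr hq) h xa mulr0 subr0.
Qed.

Lemma reflections_polar s v w : all pure_nonnull s ->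
  <<foldr reflection v s, foldr reflection w s>> = <<v, w>>.
Proof. by elim: s => //= a s IH /andP[/andP[_ a0] /IH h]; rewrite reflection_polar. Qed.

Lemma oact_lin s c y z : oact s (c *: y + z) = c *: oact s y + oact s z.
Proof. by elim: s => //= a s ->; rewrite (omul_linr ho). Qed.

Lemma oact0 s : oact s 0 = 0.
Proof. by elim: s => //= a s ->; rewrite (omul0r ho). Qed.

Lemma oactZ s c y : oact s (c *: y) = c *: oact s y.
Proof. by rewrite -[c *: y]addr0 oact_lin oact0 addr0. Qed.

Lemma norm_oact s y : n (oact s y) = \prod_(a <- s) n a * n y.
Proof.
elim: s => [|a s /= IH]; first by rewrite big_nil mul1r.
by rewrite big_cons (onormM ho) IH mulrA.
Qed.

(** One letter at a time: [a(vy) = - (a, v) y - v(ay)], and substituting [y = - a(ay) / n(a)] in the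
    first term gives [(- s_a v)(ay)]. *)
Lemma oact_mul s v y : all pure_nonnull s -> <<x, v>> = 0 ->
  oact s (v ** y) = ((-1) ^+ size s *: foldr reflection v s) ** oact s y.
Proof.
move=> + xv; elim: s => /= [|a s IH]; first by rewrite expr0 scale1r.
case/andP => /andP[/eqP xa a0] ps; rewrite IH// exprS -scalerA scaleN1r.
have := reflections_pure ps xv; set r := foldr reflection v s; set z := oact s y.
move=> xr; rewrite (omulZl ho) (omulZr ho) (omulNl ho) (omulZl ho) -scalerN.
congr (_ *: _); rewrite (omul_swapl ho)// /reflection (omulDl ho) (omulNl ho).
rewrite (omulZl ho) (omul_sql ho)// scalerA mulrN divfK//.
by apply/rowP => k; rewrite !mxE; ring.
Qed.

(** The two copies of the head letter are adjacent in the middle of the word and collapse by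
    [a(az) = - n(a) z]. *)
Lemma oact_rev s y : all pure_nonnull s ->
  oact (rev s) (oact s y) = (\prod_(a <- s) - n a) *: y.
Proof.
elim: s y => [|a s IH] y /=; first by rewrite big_nil scale1r.
case/andP => /andP[/eqP xa a0] ps; rewrite big_cons rev_cons foldr_rcons.
by rewrite (omul_sql ho)// oactZ IH// scalerA.
Qed.

Section WithFrame.
Variables (g : R) (i j l : 'rV[R]_8).
Hypothesis ct : cayley_triple n x mul g i j l.
Hypothesis g0 : g != 0.
Local Notation e := (frame x mul i j l).

Lemma frame_pure a : (a < 7)%N -> <<x, e a>> = 0.
Proof.
move=> a7; rewrite -[x in <<x, _>>]/(e 7) (frame_gram hx ho ct)// 1?leqW//.
by rewrite eq_sym (ltn_eqF a7).
Qed.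

Lemma frame_normE a : (a < 7)%N -> n (e a) = frame_norm g a.
Proof.
move=> a7; have := frame_gram hx ho ct (leqW a7) (leqW a7).
by rewrite eqxx (polar_self hq) => /mulfI; apply; rewrite pnatr_eq0.
Qed.

Lemma frame_ext y z : <<y, x>> = <<z, x>> ->
  (forall a, (a < 7)%N -> <<y, e a>> = <<z, e a>>) -> y = z.
Proof.
move=> yzx yze; apply: (polar_inj ho) => w.
have [U UE] : exists U, w - (<<w, x>> / 2) *: x = frame_comb x mul i j l U.
  apply: (frame_comb_surj hx ho ct g0).
  rewrite (polarBr hq) (polarZr hq) (polar_self hq) hx (polarC n w x); lra.
rewrite -[w](subrK ((<<w, x>> / 2) *: x)) UE !(polarDr hq) !(polarZr hq) yzx.
congr (_ + _); rewrite /frame_comb !(polar_sumr hq).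
by apply: eq_bigr => a _; rewrite !(polarZr hq) yze.
Qed.

(** Induction along the frame: once [e_0], ..., [e_(k-1)] are restored, one or two reflections in
    vectors orthogonal to them bring [w], the current image of [e_k], back to [e_k]. *)
Lemma cartan_dieudonne (f : 'rV[R]_8 -> 'rV[R]_8) :
  (forall c y z, f (c *: y + z) = c *: f y + f z) ->
  (forall v, <<x, v>> = 0 -> <<x, f v>> = 0) ->
  (forall v w, <<x, v>> = 0 -> <<x, w>> = 0 -> <<f v, f w>> = <<v, w>>) ->
  exists2 s, all pure_nonnull s &
    forall v, <<x, v>> = 0 -> foldr reflection (f v) s = v.
Proof.
move=> flin fpure fpol.
have [s ps sE] : exists2 s, all pure_nonnull s &
    forall a, (a < 7)%N -> foldr reflection (f (e a)) s = e a.
  suff H k : (k <= 7)%N -> exists2 s, all pure_nonnull s &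
    forall a, (a < k)%N -> foldr reflection (f (e a)) s = e a by exact: H.
  elim: k => [|k IH] k7; first by exists [::].
  have [s ps sE] := IH (ltnW k7).
  pose v := e k; pose w := foldr reflection (f v) s.
  have xv : <<x, v>> = 0 by exact: frame_pure.
  have xw : <<x, w>> = 0 by apply: reflections_pure => //; exact: fpure.
  have vw : n v = n w.
    have : <<w, w>> = <<v, v>> by rewrite reflections_polar// fpol.
    by rewrite !(polar_self hq) => /mulfI; rewrite pnatr_eq0 => ->.
  have v0 : n v != 0 by rewrite frame_normE// frame_norm_neq0.
  have ev a : (a < k)%N -> <<v, e a>> = 0.
    move=> ak; have a7 := ltn_trans ak k7.
    by rewrite (frame_gram hx ho ct) 1?leqW// eq_sym (ltn_eqF ak).
  have ew a : (a < k)%N -> <<w, e a>> = 0.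
    move=> ak; have a7 := ltn_trans ak k7.
    by rewrite -(sE a ak) reflections_polar// fpol ?frame_pure// ev.
  (* If [w - v] is null, then [w + v] is not, by the parallelogram identity; its reflection sends
     [w] to [- v], and the reflection in [v] corrects the sign. *)
  have [wv|wv] := eqVneq (n (w - v)) 0.
    have wv' : n (w + v) != 0.
      have : n (w + v) + n (w - v) = 4 * n v.
        by rewrite (quadD n w v) (quadD n w (- v)) (quadN hq) (polarNr hq) -vw; ring.
      by rewrite wv addr0 => ->; rewrite mulf_neq0// pnatr_eq0.
    exists (v :: (w + v : 'rV[R]_8) :: s).
      by rewrite /= ps /pure_nonnull xv v0 wv' (polarDr hq) xw xv addr0 eqxx.
    move=> a; rewrite ltnS leq_eqVlt => /predU1P[->|ak] /=.
      by rewrite -/v -/w reflection_add// reflection_self.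
    by rewrite sE// !reflection_orthogonal// ?ev// (polarDl hq) ew// ev// addr0.
  exists ((w - v : 'rV[R]_8) :: s).
    by rewrite /= ps /pure_nonnull wv (polarBr hq) xw xv subr0 eqxx.
  move=> a; rewrite ltnS leq_eqVlt => /predU1P[->|ak] /=.
    by rewrite -/v -/w reflection_sub.
  by rewrite sE// reflection_orthogonal// (polarBl hq) ew// ev// subr0.
exists s => // v xv; apply: frame_ext => [|a a7].
  rewrite !(polarC n _ x) xv reflections_pure//; exact: fpure.
by rewrite -{1}(sE a a7) reflections_polar// fpol// frame_pure.
Qed.

(** * Octonions associating with orthogonal pure pairs up to a sign *)

Section AlmostNucleus.
Variables (eps : bool) (u : 'rV[R]_8).
Hypothesis hu : forall a b, <<x, a>> = 0 -> <<x, b>> = 0 -> <<a, b>> = 0 ->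
  a ** (b ** u) = (-1) ^+ eps *: ((a ** b) ** u).

Let frame_orth a b : (a < 7)%N -> (b < 7)%N -> a != b -> <<e a, e b>> = 0.
Proof.
by move=> a7 b7 /negPf ab; rewrite (frame_gram hx ho ct) 1?leqW// ab.
Qed.

(** Pairing with [x] yields [(u, ab) = - (u, ab)] for orthogonal pure [a], [b], and every frame
    vector is a nonzero multiple of such a product. The component of [u] along [x] dies by pairing
    with [e_0 e_1]. *)
Lemma skew_nucleus : eps -> u = 0.
Proof.
move=> eps1; have h a b : <<x, a>> = 0 -> <<x, b>> = 0 -> <<a, b>> = 0 ->
    a ** (b ** u) = - ((a ** b) ** u).
  by move=> *; rewrite hu// eps1 expr1 scaleN1r.
have hab a b : <<x, a>> = 0 -> <<x, b>> = 0 -> <<a, b>> = 0 -> <<u, a ** b>> = 0.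
  move=> xa xb ab; have xab : <<x, a ** b>> = 0.
    by rewrite (polar_omul_unit ho)// ab oppr0.
  have := congr1 (polar n ^~ x) (h _ _ xa xb ab).
  rewrite /= (omul_skewl ho) // (omul1r ho) (omul_skewl ho)// (polarNl hq).
  rewrite (omul_skewl ho)// (omul1r ho) (omul_anti ho xb xa) (polarC n b) ab.
  rewrite oppr0 scale0r sub0r (polarNr hq) !opprK; lra.
apply: frame_ext => [|c c7]; rewrite (polar0l hq).
  have xi := frame_pure (isT : 0 < 7)%N; have xj := frame_pure (isT : 1 < 7)%N.
  have ij := frame_orth (isT : 0 < 7)%N (isT : 1 < 7)%N isT.
  have := congr1 (polar n ^~ (e 0 ** e 1)) (h _ _ xi xj ij).
  rewrite /= (polar_mull ho) (polarNl hq).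
  have -> : <<e 1 ** u, e 1>> = n (e 1) * <<u, x>>.
    by rewrite -(polar_mull ho) (omul1r ho).
  have -> : <<e 0 ** e 1 ** u, e 0 ** e 1>> = n (e 0 ** e 1) * <<u, x>>.
    by rewrite -(polar_mull ho) (omul1r ho).
  by rewrite (onormM ho) !frame_normE// /frame_norm /=; lra.
have fin a b (a7 : (a < 7)%N) (b7 : (b < 7)%N) (ab : a != b) :
    (frame_table g a b).2 = c -> (frame_table g a b).1 != 0 -> <<u, e c>> = 0.
  move=> <- t0; have := hab _ _ (frame_pure a7) (frame_pure b7) (frame_orth a7 b7 ab).
  rewrite (frame_mul ho ct)// (polarZr hq) => /eqP.
  by rewrite mulf_eq0 (negPf t0) => /eqP.
case: c c7 fin => [|[|[|[|[|[|[|//]]]]]]] _ fin.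
- by apply: (fin 1 2)%N => //=; exact: oner_neq0.
- by apply: (fin 2 0)%N => //=; exact: oner_neq0.
- by apply: (fin 0 1)%N => //=; exact: oner_neq0.
- by apply: (fin 6 0)%N => //=; exact: oner_neq0.
- by apply: (fin 6 1)%N => //=; exact: oner_neq0.
- by apply: (fin 6 2)%N => //=; exact: oner_neq0.
- by apply: (fin 0 3)%N => //=; exact: oner_neq0.
Qed.

(** For each [c] two frame vectors are found with [e_a(e_b e_c) = - (e_a e_b)e_c]. Pairing with this
    vector equates [(u, e_c)] with its opposite. *)
Lemma nucleus : ~~ eps -> u = (<<u, x>> / 2) *: x.
Proof.
move=> /negPf eps0; have h a b : <<x, a>> = 0 -> <<x, b>> = 0 -> <<a, b>> = 0 ->
    a ** (b ** u) = (a ** b) ** u.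
  by move=> *; rewrite hu// eps0 expr0 scale1r.
apply: frame_ext => [|c c7]; rewrite (polarZl hq).
  by rewrite (polar_self hq) hx mulr1 divfK// pnatr_eq0.
rewrite frame_pure// mulr0.
(* The index conditions put [e_c] orthogonal to the quaternion subalgebra of [e_a] and [e_b], which
   forces anti-associativity. *)
have fin a b (a7 : (a < 7)%N) (b7 : (b < 7)%N) (ab : a != b) :
    a != c -> b != c -> (frame_table g a b).2 != c ->
    ((frame_table g a b).2 < 7)%N -> <<u, e c>> = 0.
  move=> ac bc tc t7; have xa := frame_pure a7; have xb := frame_pure b7.
  have xc := frame_pure c7; have oab := frame_orth a7 b7 ab.
  have oac := frame_orth a7 c7 ac; have obc := frame_orth b7 c7 bc.
  have xab : <<x, e a ** e b>> = 0 by rewrite (polar_omul_unit ho)// oab oppr0.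
  have oabc : <<e a ** e b, e c>> = 0.
    by rewrite (frame_mul ho ct)// (polarZl hq) frame_orth// mulr0.
  have E : e a ** (e b ** e c) = - (e a ** e b ** e c).
    rewrite (omul_anti ho xb xc) obc oppr0 scale0r sub0r (omulNr ho).
    rewrite (omul_swapl ho)// oac oppr0 scale0r sub0r opprK.
    by rewrite (omul_anti ho)// (polarC n) oabc oppr0 scale0r sub0r.
  have := congr1 (polar n ^~ (e a ** (e b ** e c))) (h _ _ xa xb oab).
  rewrite /= !(polar_mull ho) E (polarNr hq) (polar_mull ho) (onormM ho).
  have na : n (e a) != 0 by rewrite frame_normE// frame_norm_neq0.
  have nb : n (e b) != 0 by rewrite frame_normE// frame_norm_neq0.
  set t := <<_, _>> => /eqP; rewrite -subr_eq0.
  have -> : n (e a) * (n (e b) * t) - - (n (e a) * n (e b) * t) =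
    2 * (n (e a) * n (e b)) * t by ring.
  by rewrite !mulf_eq0 pnatr_eq0 (negPf na) (negPf nb) => /eqP.
case: c c7 fin => [|[|[|[|[|[|[|//]]]]]]] _ fin.
- by apply: (fin 1 3)%N.
- by apply: (fin 0 3)%N.
- by apply: (fin 0 3)%N.
- by apply: (fin 0 1)%N.
- by apply: (fin 0 1)%N.
- by apply: (fin 0 1)%N.
- by apply: (fin 0 1)%N.
Qed.

End AlmostNucleus.

(** A word [s] of reflections undoes [f] on pure octonions. The word acting after [f] is then
    multiplication by a scalar [al], so [f] is a multiple of the reversed word, and the scalar is
    absorbed into a letter. *)
Lemma automorphism_oact (f : 'rV[R]_8 -> 'rV[R]_8) :
  (forall c y z, f (c *: y + z) = c *: f y + f z) ->
  f x = x -> (forall y z, <<f y, f z>> = <<y, z>>) ->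
  (forall v y, <<x, v>> = 0 -> f (v ** y) = f v ** f y) ->
  exists s, [/\ all pure_nonnull s, ~~ odd (size s), \prod_(a <- s) n a = 1
    & forall y, f y = oact s y].
Proof.
move=> flin fx fpol fmul.
have fpure v : <<x, v>> = 0 -> <<x, f v>> = 0 by rewrite -[in X in _ -> X]fx fpol.
have [s ps sE] := cartan_dieudonne flin fpure (fun v w _ _ => fpol v w).
pose t y := oact s (f y); pose u := t x.
have tmul v y : <<x, v>> = 0 -> t (v ** y) = (-1) ^+ odd (size s) *: (v ** t y).
  by move=> xv; rewrite /t fmul// oact_mul ?fpure// sE// (omulZl ho) signr_odd.
have tv v : <<x, v>> = 0 -> t v = (-1) ^+ odd (size s) *: (v ** u).
  by move=> xv; rewrite -[v in LHS](omul1r ho) tmul.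
have hu a b : <<x, a>> = 0 -> <<x, b>> = 0 -> <<a, b>> = 0 ->
    a ** (b ** u) = (-1) ^+ odd (size s) *: ((a ** b) ** u).
  move=> xa xb ab; rewrite -tv; last by rewrite (polar_omul_unit ho)// ab oppr0.
  by rewrite tmul// tv// (omulZr ho) scalerA -expr2 sqrr_sign scale1r.
have prod0 : \prod_(a <- s) n a != 0.
  rewrite prodf_seq_neq0; apply/allP => a /(allP ps) /andP[_ a0]; exact: a0.
have nu : n u = \prod_(a <- s) n a by rewrite /u /t fx norm_oact hx mulr1.
have even_s : ~~ odd (size s).
  apply/negP => /(skew_nucleus hu) u0.
  by move: prod0; rewrite -nu u0 (quad0 hq) eqxx.
pose al := <<u, x>> / 2.
have uE : u = al *: x := nucleus hu even_s.
have al2 : al ^+ 2 = \prod_(a <- s) n a by rewrite -nu uE (quadZ hq) hx mulr1.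
have al0 : al != 0 by move: prod0; rewrite -al2 expf_eq0.
have tE y : t y = al *: y.
  pose v := y - (<<y, x>> / 2) *: x.
  have xv : <<x, v>> = 0.
    by rewrite (polarBr hq) (polarZr hq) (polar_self hq) hx (polarC n y x); lra.
  have -> : y = (<<y, x>> / 2) *: x + v by rewrite addrC subrK.
  rewrite /t flin oact_lin -/(t v) -/(t x) -/u tv// (negPf even_s) expr0 scale1r uE.
  by rewrite (omulZr ho) (omul1r ho); apply/rowP => k; rewrite !mxE; ring.
have revE y : f y = al^-1 *: oact (rev s) y.
  have : oact (rev s) (t y) = (\prod_(a <- s) - n a) *: f y by rewrite oact_rev.
  rewrite tE oactZ.
  have -> : \prod_(a <- s) - n a = al ^+ 2.
    under eq_bigr do rewrite -mulN1r.
    rewrite big_split /= al2 big_const_seq count_predT.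
    by rewrite iter_mulr_1 -signr_odd (negPf even_s) expr0 mul1r.
  rewrite expr2 -(scalerA al al) => e0; have {e0}e1 := scalerI al0 e0.
  by rewrite e1 scalerA mulVf// scale1r.
(* The empty word has no letter to absorb [al^-1], but then [al = 1]. *)
have [s0|s0] := eqVneq s [::].
  exists [::]; split; rewrite ?big_nil//= => y; rewrite revE s0 /=.
  have -> : al = 1.
    by rewrite /al /u /t s0 /= fx (polar_self hq) hx mulr1 divff// pnatr_eq0.
  by rewrite invr1 scale1r.
have sr : size (rev s) = size s by rewrite size_rev.
have prodr : \prod_(a <- rev s) n a = al ^+ 2.
  by rewrite al2; apply: perm_big; rewrite perm_rev.
have pr : all pure_nonnull (rev s) by rewrite all_rev.
case E : (rev s) sr prodr pr revE => [|a s'].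
  by move=> /esym/size0nil s1; rewrite s1 in s0.
rewrite -/(size (a :: s')) => sz; rewrite big_cons => pa.
move=> /= /andP[/andP[/eqP xa a0] ps'] revE.
(* The norms of the reversed word multiply to [al ^+ 2], so this scaling makes their product 1. *)
exists (al^-1 *: a :: s'); split.
- rewrite /= ps' /pure_nonnull (polarZr hq) xa mulr0 eqxx (quadZ hq).
  by rewrite mulf_neq0// expf_neq0// invr_eq0.
- by rewrite [size _]sz.
- by rewrite big_cons (quadZ hq) -mulrA pa exprVn mulVf// expf_neq0.
- by move=> y; rewrite revE /= (omulZl ho).
Qed.

End WithFrame.
End CliffordAction.

(** * Linear maps preserving the 3-form *)

Section PolynomialOnLines.
Context {R : realType} {U : lmodType R}.

(** This weak form of polynomiality suffices for cancelling a factor in an identity between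
    functions. *)
Definition poly_on_lines (f : U -> R) : Prop :=
  forall y z, exists p : {poly R}, forall t, f (y + t *: z) = p.[t].

Lemma poly_on_linesM f h : poly_on_lines f -> poly_on_lines h ->
  poly_on_lines (fun y => f y * h y).
Proof.
move=> pf ph y z; have [p pE] := pf y z; have [q qE] := ph y z.
by exists (p * q) => t; rewrite pE qE hornerM.
Qed.

Lemma poly_on_linesD f h : poly_on_lines f -> poly_on_lines h ->
  poly_on_lines (fun y => f y + h y).
Proof.
move=> pf ph y z; have [p pE] := pf y z; have [q qE] := ph y z.
by exists (p + q) => t; rewrite pE qE hornerD.
Qed.

Lemma poly_on_linesZ c f : poly_on_lines f -> poly_on_lines (fun y => c * f y).
Proof.
by move=> pf y z; have [p pE] := pf y z; exists (c *: p) => t; rewrite pE hornerZ.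
Qed.

Lemma horner_eq0_poly (p : {poly R}) : (forall t, p.[t] = 0) -> p = 0.
Proof.
move=> p0; apply/eqP; apply: contraT => pn0.
have := max_poly_roots pn0 (rs := [seq i%:R : R | i <- iota 0 (size p)]).
rewrite size_map size_iota ltnn => -> //.
  by apply/allP => t _; rewrite /root p0.
by rewrite map_inj_uniq ?iota_uniq// => a b /eqP; rewrite eqr_nat => /eqP.
Qed.

(** On the line joining [z] to a point where [f] is nonzero, the two polynomials have product zero
    in an integral domain. *)
Lemma poly_on_lines_domain f h : poly_on_lines f -> poly_on_lines h ->
  (forall y, f y * h y = 0) -> (exists y, f y != 0) -> forall z, h z = 0.
Proof.
move=> pf ph fh [y fy] z; have [p pE] := pf y (z - y); have [q qE] := ph y (z - y).
have /horner_eq0_poly/eqP : forall t, (p * q).[t] = 0.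
  by move=> t; rewrite hornerM -pE -qE fh.
rewrite mulf_eq0 => /orP[/eqP p0|/eqP q0].
  by have := pE 0; rewrite p0 horner0 scale0r addr0 => fy0; rewrite fy0 eqxx in fy.
by have := qE 1; rewrite q0 horner0 scale1r addrC subrK.
Qed.

Lemma quadratic_on_lines (q : U -> R) : quadratic_form q -> poly_on_lines q.
Proof.
move=> hq y z; exists ((q y)%:P + (polar q y z) *: 'X + (q z) *: 'X^2) => t.
rewrite (quadD q) (quadZ hq) (polarZr hq) !hornerD !hornerZ.
by rewrite hornerC hornerX hornerXn; ring.
Qed.

End PolynomialOnLines.

Section FormStabilizer.
Context {R : realType} (n : 'rV[R]_8 -> R) (x : 'rV[R]_8).
Context (mul : 'rV[R]_8 -> 'rV[R]_8 -> 'rV[R]_8).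
Hypothesis hx : n x = 1.
Hypothesis ho : octonion_algebra n x mul.

Let hq : quadratic_form n := octonion_norm ho.
Local Notation "<< y , z >>" := (polar n y z) (at level 0).
Local Infix "**" := mul (at level 40, left associativity).

Definition lmul_mx (a : 'rV[R]_8) : 'M[R]_8 := \matrix_i (a ** delta_mx 0 i).

Lemma mul_lmul_mx a y : y *m lmul_mx a = a ** y.
Proof.
rewrite mulmx_sum_row [y in RHS]row_sum_delta (omul_sumr ho).
by apply: eq_bigr => i _; rewrite rowK (omulZr ho).
Qed.

(** Left multiplication by a pure [a] squares to the scalar [- n a], in dimension 8. *)
Lemma det_lmul_mx a : <<x, a>> = 0 -> \det (lmul_mx a) ^+ 2 = n a ^+ 8.
Proof.
move=> xa; rewrite expr2 -det_mulmx.
suff -> : lmul_mx a *m lmul_mx a = (- n a)%:M by rewrite det_scalar; ring.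
apply/row_matrixP => i; rewrite !rowE mulmxA !mul_lmul_mx (omul_sql ho)//.
by rewrite mul_mx_scalar.
Qed.

Lemma gram_unit : gram n \in unitmx.
Proof.
rewrite -row_free_unit -kermx_eq0; apply/rowV0P => w /sub_kermxP wG.
by apply: (octonion_nondegenerate ho) => z; rewrite -gramE// wG mul0mx mxE.
Qed.

Variables (Omega : 'cV[R]_7 -> 'cV[R]_7 -> 'cV[R]_7 -> R) (P : 'M[R]_(7, 8)).
Hypothesis af : adapted_frame n x mul Omega P.

Local Notation "u ^~P" := (u^T *m P) (at level 2).

Definition full_frame : 'M[R]_(1 + 7, 8) := col_mx x P.

Lemma full_frameE (a : 'M[R]_1) (c : 'rV[R]_7) :
  row_mx a c *m full_frame = a 0 0 *: x + c *m P.
Proof. by rewrite mul_row_col [a in LHS]mx11_scalar mul_scalar_mx. Qed.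

Lemma full_frame_unit : full_frame \in unitmx.
Proof.
suff /submxP[D DQ] : (1%:M <= full_frame)%MS.
  by have /mulmx1_unit[] := esym DQ.
apply/row_subP => i; set y := row i _.
have [u uE] : exists u : 'cV_7, y - (<<y, x>> / 2) *: x = u ^~P.
  apply: (adapted_span af).
  by rewrite (polarBr hq) (polarZr hq) (polar_self hq) hx (polarC n x y); lra.
rewrite -[y](subrK ((<<y, x>> / 2) *: x)) uE addrC.
have -> : (<<y, x>> / 2) *: x + u ^~P = row_mx (<<y, x>> / 2)%:M u^T *m full_frame.
  by rewrite full_frameE mxE mulr1n.
exact: submxMl.
Qed.

Definition frame_gram_mx : 'M[R]_7 := P *m gram n *m P^T.
Local Notation N := frame_gram_mx.

Lemma frame_gram_mxE (u v : 'cV[R]_7) : (u^T *m N *m v) 0 0 = <<u ^~P, v ^~P>>.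
Proof. by rewrite -gramE// trmx_mul trmxK !mulmxA. Qed.

(** In the basis made of [x] and the rows of [P], the Gram matrix of [n] is block diagonal with
    blocks 2 and [N]. *)
Lemma frame_gram_mx_unit : N \in unitmx.
Proof.
have : \det (full_frame *m gram n *m full_frame^T) != 0.
  by rewrite !det_mulmx det_tr !mulf_neq0// -unitfE -unitmxE
    ?full_frame_unit ?gram_unit.
suff -> : full_frame *m gram n *m full_frame^T = block_mx 2%:M 0 0 N.
  by rewrite det_ublock mulf_eq0 negb_or unitmxE unitfE => /andP[].
have xP : x *m gram n *m P^T = 0.
  apply/rowP => i; rewrite gram_mulE// !mxE row_id rowE -[delta_mx _ _]trmxK.
  exact: (adapted_perp af).
rewrite /full_frame tr_col_mx mul_col_mx mul_col_row xP; congr block_mx.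
  by apply/matrixP => i j; rewrite !ord1 gramE// (polar_self hq) hx mxE mulr1 mulr1n.
apply: trmx_inj; rewrite trmx0 -xP !trmx_mul trmxK -!mulmxA; congr (_ *m (_ *m _)).
by apply/matrixP => i j; rewrite !mxE polarC.
Qed.

(** The matrix of the contraction of [2 * Omega] with [u], expressed through left multiplication. *)
Definition contraction (u : 'cV[R]_7) : 'M[R]_7 :=
  P *m lmul_mx (u ^~P) *m gram n *m P^T.
Local Notation M := contraction.

Lemma contractionE u v w : (v^T *m M u *m w) 0 0 = 2 * Omega u v w.
Proof.
by rewrite -(adapted_form af) -gramE// trmx_mul trmxK -mul_lmul_mx !mulmxA.
Qed.

Lemma mx7_ext (A B : 'M[R]_7) :
  (forall v w : 'cV[R]_7, (v^T *m A *m w) 0 0 = (v^T *m B *m w) 0 0) -> A = B.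
Proof.
move=> AB; apply/matrixP => i j; have := AB (delta_mx i 0) (delta_mx j 0).
by rewrite !trmx_delta -!rowE -!colE !mxE.
Qed.

Lemma contraction_skew u : (M u)^T = - M u.
Proof.
apply: mx7_ext => v w; rewrite mulmxN mulNmx [RHS]mxE contractionE.
have -> : v^T *m (M u)^T *m w = (w^T *m M u *m v)^T.
  by rewrite [RHS]trmx_mul [(w^T *m _)^T]trmx_mul trmxK mulmxA.
rewrite mxE contractionE -!(adapted_form af) polarC.
by rewrite [in RHS](omul_skewl ho) ?opprK// (adapted_perp af).
Qed.

Definition bordered u (xi : 'rV[R]_7) : 'M[R]_(1 + 7) :=
  block_mx 0 xi (- xi^T) (M u).

Definition flat (u : 'cV[R]_7) : 'rV[R]_7 := u^T *m N.

(** Both sides are the matrix of [(y, z) -> (uy, z)] on the whole algebra; the border comes from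
    [u ** x = u]. *)
Lemma bordered_flat u : bordered u (flat u) =
  full_frame *m lmul_mx (u ^~P) *m gram n *m full_frame^T.
Proof.
have xu : <<x, u ^~P>> = 0 := adapted_perp af u.
have uP : u ^~P *m gram n *m P^T = flat u by rewrite /flat /frame_gram_mx !mulmxA.
rewrite /full_frame tr_col_mx 2!mul_col_mx mul_col_row mul_lmul_mx (omul1r ho) uP.
congr block_mx.
  by apply/matrixP => i j; rewrite !ord1 gramE// mxE polarC xu.
apply/colP => i; rewrite -uP !gram_mulE// !mxE !row_id row_mul mul_lmul_mx.
by rewrite (omul_skewl ho)// (omul1r ho) polarC.
Qed.

(** Invariance of the form reads [g^T M(gu) g = M(u)], so the two bordered matrices are congruent by
    the block diagonal matrix of 1 and [g]. *)
Lemma bordered_form_stabilizer g u xi : form_stabilizer Omega g ->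
  \det g ^+ 2 * \det (bordered (g *m u) xi) = \det (bordered u (xi *m g)).
Proof.
move=> [gu gO]; have gM : g^T *m M (g *m u) *m g = M u.
  apply: mx7_ext => v w; rewrite contractionE -gO -contractionE trmx_mul !mulmxA.
  by [].
have -> : bordered u (xi *m g) =
    block_mx 1%:M 0 0 g^T *m bordered (g *m u) xi *m block_mx 1%:M 0 0 g.
  rewrite /bordered !mulmx_block !mul0mx !mulmx0 !mul1mx !mulmx1 !addr0 !add0r gM.
  by rewrite trmx_mul mulmxN.
rewrite !det_mulmx !det_ublock det_tr !det1; ring.
Qed.

(** Congruence by the triangular matrix [L] of determinant [a]; the corner stays 0 since
    [w M(u) w^T = 0] for the skew [M(u)]. *)
Lemma bordered_shift u xi w a :
  \det (bordered u (a *: xi + w *m M u)) = a ^+ 2 * \det (bordered u xi).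
Proof.
pose L : 'M[R]_(1 + 7) := block_mx a%:M w 0 1%:M.
suff -> : bordered u (a *: xi + w *m M u) = L *m bordered u xi *m L^T.
  rewrite !det_mulmx det_tr det_ublock det1 det_scalar1; ring.
rewrite /L tr_block_mx !tr_scalar_mx trmx0 /bordered !mulmx_block.
rewrite !mul0mx !mulmx0 !mul1mx !mulmx1 !add0r !mulmxN !mul_scalar_mx !mul_mx_scalar.
have Mskew := contraction_skew u.
have sk1 (A : 'M[R]_1) : A^T = - A -> A = 0.
  move=> AA; apply/matrixP => i j; have := congr1 (fun B : 'M[R]_1 => B 0 0) AA.
  by rewrite !ord1 !mxE; lra.
congr block_mx.
  have tr1 (A : 'M[R]_1) : A^T = A by apply/matrixP => i j; rewrite !ord1 mxE.
  have wMw : w *m M u *m w^T = 0.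
    by apply: sk1; rewrite trmx_mul trmxK trmx_mul Mskew mulNmx mulmxN mulmxA.
  have xw : xi *m w^T = w *m xi^T by rewrite -[RHS]tr1 trmx_mul trmxK.
  by rewrite mulmxDl -scalemxAl wMw addr0 xw scalerN addNr.
rewrite !linearD /= !linearZ /= trmx_mul Mskew.
by rewrite mulNmx opprK.
Qed.

(* Where n (u P) <> 0, the functional n (gu P, g . P) is a multiple of
   n (u P, . P) up to a vector killed by u, hence lies in the image of M u. *)
Lemma form_stabilizer_norm g u : form_stabilizer Omega g -> n (u ^~P) != 0 ->
  n ((g *m u) ^~P) ^+ 8 * \det g ^+ 4 = n ((g *m u) ^~P) ^+ 4 * n (u ^~P) ^+ 4.
Proof.
move=> gO u0; set a := n ((g *m u) ^~P); set b := n (u ^~P) in u0 *.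
pose eta := flat (g *m u) *m g - (a / b) *: flat u.
have xu := adapted_perp af u.
have [w wE] : exists w : 'rV_7, eta = w *m M u.
  pose p : 'cV[R]_7 := (eta *m invmx N)^T.
  have pE : flat p = eta by rewrite /flat trmxK mulmxKV// frame_gram_mx_unit.
  have pu : <<p ^~P, u ^~P>> = 0.
    rewrite -frame_gram_mxE -[_ *m N]/(flat p) pE /eta mulmxBl -scalemxAl.
    have e1 : (flat (g *m u) *m g *m u) 0 0 = 2 * a.
      by rewrite -mulmxA frame_gram_mxE (polar_self hq).
    have e2 : (flat u *m u) 0 0 = 2 * b by rewrite frame_gram_mxE (polar_self hq).
    rewrite mxE e1 [X in _ + X](_ : _ = - (a / b * (flat u *m u) 0 0)); last first.
      by rewrite mxE; congr (- _); rewrite mxE.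
    by rewrite e2; field.
  have xp := adapted_perp af p.
  (* Left multiplication by [u] is inverted through [u(up) = - b p]; the preimage is pure because
     [p] is orthogonal to [u]. *)
  have [w wE] : exists w : 'cV_7, - b^-1 *: (u ^~P ** p ^~P) = w ^~P.
    apply: (adapted_span af); rewrite (polarZr hq) (polar_omul_unit ho)//.
    by rewrite polarC pu oppr0 mulr0.
  exists w^T; rewrite -pE /contraction !mulmxA -wE -scalemxAl mul_lmul_mx.
  rewrite (omul_sql ho)//.
  by rewrite -/b scalerA mulrNN mulVf// scale1r /flat /frame_gram_mx !mulmxA.
have xgu := adapted_perp af (g *m u).
have := bordered_form_stabilizer u (flat (g *m u)) gO.
have -> : flat (g *m u) *m g = (a / b) *: flat u + w *m M u.
  by rewrite -wE /eta addrC subrK.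
rewrite bordered_shift !bordered_flat !det_mulmx det_tr.
have := det_lmul_mx xu; have := det_lmul_mx xgu; rewrite -/a -/b.
set la := \det (lmul_mx ((g *m u) ^~P)); set lb := \det (lmul_mx (u ^~P)).
have Q0 : \det full_frame != 0 by rewrite -unitfE -unitmxE full_frame_unit.
have G0 : \det (gram n) != 0 by rewrite -unitfE -unitmxE gram_unit.
set q := \det full_frame in Q0 *; set h := \det (gram n) in G0 *.
move=> la2 lb2 E.
have {}E : \det g ^+ 2 * la = (a / b) ^+ 2 * lb.
  apply: (@mulIf _ (q * h * q)); first by rewrite !mulf_neq0.
  transitivity (\det g ^+ 2 * (q * la * h * q)); first by ring.
  by rewrite E; set r := a / b; ring.
(* Only the squares of [la] and [lb] are known, so the identity is squared. *)
have {E} : \det g ^+ 4 * a ^+ 8 = (a / b) ^+ 4 * b ^+ 8.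
  by rewrite -la2 -lb2 -[4%N]/(2 * 2)%N !exprM -!exprMn E.
by rewrite mulrC => ->; field.
Qed.

Definition frame_quad (u : 'cV[R]_7) : R := n (u ^~P).

Lemma frame_quad_quadratic (g : 'M[R]_7) :
  quadratic_form (fun u => frame_quad (g *m u)).
Proof.
split=> [c u|].
  by rewrite /frame_quad -scalemxAr linearZ /= -scalemxAl (quadZ hq).
have E u v : polar (fun u => frame_quad (g *m u)) u v = <<(g *m u) ^~P, (g *m v) ^~P>>.
  by rewrite /polar /frame_quad mulmxDr linearD /= mulmxDl.
split=> [v c u u'|v c u u'].
  by rewrite !E mulmxDr linearD /= mulmxDl (polarDl hq) -scalemxAr linearZ /=
    -scalemxAl (polarZl hq).
by rewrite !E mulmxDr linearD /= mulmxDl (polarDr hq) -scalemxAr linearZ /=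
  -scalemxAl (polarZr hq).
Qed.

Lemma frame_quad_neq0 : exists u, frame_quad u != 0.
Proof.
apply: contrapT => h; have nE u : n (u ^~P) = 0.
  by apply: contrapT => hu; apply: h; exists u; apply/eqP.
have N0 : N = 0.
  apply: mx7_ext => v w; rewrite frame_gram_mxE mulmx0 mul0mx mxE /polar.
  by rewrite -mulmxDl -linearD /= !nE; ring.
have := frame_gram_mx_unit; rewrite N0 unitmxE det0 unitr0 //.
Qed.

Lemma form_stabilizer_isometry g u : form_stabilizer Omega g ->
  n ((g *m u) ^~P) = n (u ^~P).
Proof.
move=> gO; have gu := gO.1; set d := \det g.
have d0 : d != 0 by rewrite -unitfE -unitmxE.
pose q2 v := frame_quad (g *m v).
have p1 : poly_on_lines frame_quad.
  move=> y z; have [p pE] := quadratic_on_lines (frame_quad_quadratic 1%:M) y z.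
  by exists p => t; rewrite -pE mul1mx.
have p2 : poly_on_lines q2 := quadratic_on_lines (frame_quad_quadratic g).
have p3 c : poly_on_lines (fun v => d * q2 v + c * frame_quad v).
  by apply: poly_on_linesD; apply: poly_on_linesZ.
(* The first two factors absorb the null vectors, where the comparison of determinants says nothing;
   the identity then holds everywhere and factors can be cancelled. *)
have prod0 v : frame_quad v * (q2 v * ((d * q2 v + (-1) * frame_quad v)
    * (d * q2 v + 1 * frame_quad v))) = 0.
  have [->|v0] := eqVneq (frame_quad v) 0; first by rewrite mul0r.
  have [->|w0] := eqVneq (q2 v) 0; first by rewrite !(mul0r, mulr0).
  have := form_stabilizer_norm gO v0; rewrite -/d -/(q2 v) -/(frame_quad v).
  rewrite -[X in X = _ -> _]/(q2 v ^+ 8 * d ^+ 4) => E.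
  have {}E : (d * q2 v) ^+ 4 = frame_quad v ^+ 4.
    apply: (@mulfI _ (q2 v ^+ 4)); first by rewrite expf_neq0.
    by rewrite -E; ring.
  have {}E : ((d * q2 v) ^+ 2 - frame_quad v ^+ 2) *
             ((d * q2 v) ^+ 2 + frame_quad v ^+ 2) = 0.
    by rewrite -subr_sqr -!exprM E subrr.
  move/eqP: E; rewrite mulf_eq0 => /orP[/eqP E|].
    transitivity (frame_quad v * q2 v * ((d * q2 v) ^+ 2 - frame_quad v ^+ 2)).
      ring.
    by rewrite E mulr0.
  (* A sum of two real squares vanishes only if both do, contrary to [v0]. *)
  by rewrite paddr_eq0 ?sqr_ge0// !sqrf_eq0 (negPf v0) andbF.
have ex1 : exists v, frame_quad v != 0 := frame_quad_neq0.
have ex2 : exists v, q2 v != 0.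
  have [v v0] := ex1; exists (invmx g *m v); rewrite /q2 mulmxA mulmxV// mul1mx //.
have prod1 := poly_on_lines_domain p1
  (poly_on_linesM p2 (poly_on_linesM (p3 _) (p3 _))) prod0 ex1.
have prod2 := poly_on_lines_domain p2 (poly_on_linesM (p3 _) (p3 _)) prod1 ex2.
(* One of the two remaining factors vanishes identically, again by cancellation. *)
have [s s2 sE] : exists2 s, s ^+ 2 = 1 & forall v, d * q2 v = s * frame_quad v.
  have [[v v0]|h] := pselect (exists v, d * q2 v + (-1) * frame_quad v != 0).
    exists (-1); first by rewrite sqrrN expr1n.
    move=> w; have := poly_on_lines_domain (p3 _) (p3 _) prod2 (ex_intro _ v v0) w.
    by move=> /eqP; rewrite mul1r addr_eq0 => /eqP ->; rewrite mulN1r.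
  exists 1; first by rewrite expr1n.
  move=> v; apply: contrapT => hv; apply: h; exists v.
  by rewrite mulN1r subr_eq0; apply/eqP => e; apply: hv; rewrite mul1r.
have NE : d *: (g^T *m N *m g) = s *: N.
  apply: mx7_ext => v w; rewrite -!scalemxAr -!scalemxAl mxE [RHS]mxE frame_gram_mxE.
  have -> : v^T *m (g^T *m N *m g) *m w = (g *m v)^T *m N *m (g *m w).
    by rewrite trmx_mul !mulmxA.
  have qD y z : <<y ^~P, z ^~P>> = frame_quad (y + z) - frame_quad y - frame_quad z.
    by rewrite /polar /frame_quad linearD /= mulmxDl.
  by rewrite frame_gram_mxE !qD -mulmxDr !mulrBr -!/(q2 _) !sE.
(* Determinants of [NE]: the scalar [d] in size 7 and the two copies of [g] give [d ^+ 9], against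
   [s ^+ 7 = s]. *)
have : d ^+ 9 = s.
  have := congr1 determinant NE; rewrite !detZ !det_mulmx det_tr -/d => dE.
  have N0 : \det N != 0 by rewrite -unitfE -unitmxE frame_gram_mx_unit.
  apply: (mulIf N0); transitivity (d ^+ 7 * (d * \det N * d)); first by ring.
  rewrite dE; congr (_ * _).
  by rewrite (_ : s ^+ 7 = s * (s ^+ 2) ^+ 3); [rewrite s2 expr1n mulr1|ring].
move=> ds.
have d2 : d ^+ 2 = 1.
  by apply/eqP; rewrite -(@pexpr_eq1 _ _ 9) ?sqr_ge0// -exprM mulnC exprM ds s2.
have sd : s = d.
  by rewrite -ds (_ : d ^+ 9 = d * (d ^+ 2) ^+ 4); [rewrite d2 expr1n mulr1|ring].
by apply: (mulfI d0); rewrite -[in RHS]sd; exact: sE.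
Qed.

End FormStabilizer.

(** * Octonion automorphisms and the stabilizer of the 3-form *)

Section Automorphisms.
Context {R : realType} (n : 'rV[R]_8 -> R) (x : 'rV[R]_8).
Context (mul : 'rV[R]_8 -> 'rV[R]_8 -> 'rV[R]_8).
Hypothesis hx : n x = 1.
Hypothesis ho : octonion_algebra n x mul.
Variables (Omega : 'cV[R]_7 -> 'cV[R]_7 -> 'cV[R]_7 -> R) (P : 'M[R]_(7, 8)).
Hypothesis af : adapted_frame n x mul Omega P.

Let hq : quadratic_form n := octonion_norm ho.
Local Notation "<< y , z >>" := (polar n y z) (at level 0).
Local Infix "**" := mul (at level 40, left associativity).
Local Notation "u ^~P" := (u^T *m P) (at level 2).
Local Notation Q := (full_frame x P).

(** As [x] is fixed, the product rule for pure left factors extends to all factors by linearity. *)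
Record octonion_automorphism (E : 'M[R]_8) : Prop := {
  aut_unit : x *m E = x;
  aut_norm : forall y, n (y *m E) = n y;
  aut_mul : forall v y, <<x, v>> = 0 -> (v ** y) *m E = (v *m E) ** (y *m E)
}.

Lemma automorphism_polar E y z : octonion_automorphism E ->
  <<y *m E, z *m E>> = <<y, z>>.
Proof. by move=> aE; rewrite /polar -mulmxDl !(aut_norm aE). Qed.

Lemma automorphism_pure E v : octonion_automorphism E ->
  <<x, v>> = 0 -> <<x, v *m E>> = 0.
Proof.
by move=> aE; rewrite -[in X in _ -> <<X, _>> = 0](aut_unit aE) automorphism_polar.
Qed.

(** The block of the inverse base change that reads coordinates along the rows of [P]. *)
Definition pure_coords : 'M[R]_(8, 7) := rsubmx (invmx Q : 'M[R]_(8, 1 + 7)).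

Let QQ : Q *m invmx Q = 1%:M.
Proof. by rewrite mulmxV// (full_frame_unit hx ho af). Qed.

Lemma mul_frame_coords : P *m pure_coords = 1%:M.
Proof.
have := QQ; rewrite -[invmx Q]hsubmxK /full_frame mul_col_row.
by rewrite -/pure_coords scalar_mx_block => /eq_block_mx[].
Qed.

Lemma pure_coordsK v : <<x, v>> = 0 -> v *m pure_coords *m P = v.
Proof.
move=> /(adapted_span af)[u ->].
by rewrite -(mulmxA _ P) mul_frame_coords mulmx1.
Qed.

(** The transpose passes from the right action on rows to the left action on columns, and so
    reverses products. *)
Definition restrict_mx (E : 'M[R]_8) : 'M[R]_7 := (P *m E *m pure_coords)^T.

Definition extend_mx (g : 'M[R]_7) : 'M[R]_8 :=
  invmx Q *m (block_mx 1%:M 0 0 g^T : 'M[R]_(1 + 7)) *m Q.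

Lemma extend_mx_unit g : x *m extend_mx g = x.
Proof.
have xE : x = row_mx 1%:M 0 *m Q by rewrite full_frameE mxE mulr1n scale1r mul0mx addr0.
rewrite /extend_mx {1}xE !mulmxA mulmxK ?(full_frame_unit hx ho af)//.
by rewrite mul_row_block !mul0mx mulmx0 mul1mx !addr0 -xE.
Qed.

Lemma extend_mx_pure g (u : 'cV_7) : u ^~P *m extend_mx g = (g *m u) ^~P.
Proof.
have uE (v : 'cV_7) : v ^~P = row_mx 0 v^T *m Q.
  by rewrite full_frameE mxE scale0r add0r.
rewrite /extend_mx !uE !mulmxA mulmxK ?(full_frame_unit hx ho af)//.
by rewrite mul_row_block !mul0mx mulmx0 !add0r trmx_mul.
Qed.

Lemma extend_mxK g : restrict_mx (extend_mx g) = g.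
Proof.
apply: trmx_inj; move: (extend_mx g) (extend_mx_pure g) => E EE.
rewrite /restrict_mx trmxK; apply/row_matrixP => i.
rewrite !rowE !mulmxA -[delta_mx _ _]trmxK EE.
by rewrite -mulmxA mul_frame_coords mulmx1 trmx_mul trmxK.
Qed.

Lemma restrict_mxE E (u : 'cV_7) : octonion_automorphism E ->
  (restrict_mx E *m u) ^~P = u ^~P *m E.
Proof.
move=> aE; rewrite trmx_mul trmxK !mulmxA pure_coordsK//.
by apply: automorphism_pure => //; exact: (adapted_perp af).
Qed.

Lemma pure_decomposition y : exists c u, y = c *: x + u ^~P.
Proof.
have [u uE] : exists u : 'cV_7, y - (<<y, x>> / 2) *: x = u ^~P.
  apply: (adapted_span af).
  by rewrite (polarBr hq) (polarZr hq) (polar_self hq) hx (polarC n x y); lra.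
by exists (<<y, x>> / 2), u; rewrite -uE addrC subrK.
Qed.

Lemma mx8_ext (E F : 'M[R]_8) : x *m E = x *m F ->
  (forall u : 'cV_7, u ^~P *m E = u ^~P *m F) -> E = F.
Proof.
move=> xEF uEF; apply/row_matrixP => i; rewrite !rowE.
have [c [u ->]] := pure_decomposition (delta_mx 0 i).
by rewrite !mulmxDl -!scalemxAl xEF uEF.
Qed.

Lemma restrict_mxK E : octonion_automorphism E -> extend_mx (restrict_mx E) = E.
Proof.
move=> aE; apply: mx8_ext; first by rewrite extend_mx_unit (aut_unit aE).
by move=> u; rewrite extend_mx_pure restrict_mxE.
Qed.

Lemma restrict_mxM E F : octonion_automorphism E ->
  restrict_mx (E *m F) = restrict_mx F *m restrict_mx E.
Proof.
move=> aE; apply: trmx_inj; rewrite trmx_mul !trmxK.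
apply/row_matrixP => i; rewrite !rowE !mulmxA -[delta_mx _ _]trmxK.
rewrite [_ *m pure_coords *m P]pure_coordsK//.
by apply: automorphism_pure => //; exact: (adapted_perp af).
Qed.

(** The form is built from the product and the polar form; invertibility follows from [g^T N g = N]
    with [N] invertible. *)
Lemma restrict_form_stabilizer E : octonion_automorphism E ->
  form_stabilizer Omega (restrict_mx E).
Proof.
move=> aE; have mulE := aut_mul aE; split=> [|u v w]; last first.
  apply: (@mulfI _ 2); first by rewrite pnatr_eq0.
  rewrite -!(adapted_form af) !restrict_mxE// -mulE ?(adapted_perp af)//.
  exact: automorphism_polar.
set g := restrict_mx E; pose N := frame_gram_mx n P.
have NE : g^T *m N *m g = N.
  apply: mx7_ext => v w.
  have -> : v^T *m (g^T *m N *m g) *m w = (g *m v)^T *m N *m (g *m w).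
    by rewrite trmx_mul !mulmxA.
  by rewrite !(frame_gram_mxE ho) !restrict_mxE// automorphism_polar.
have := frame_gram_mx_unit hx ho af; rewrite -/N -NE.
by rewrite unitmx_mul => /andP[_].
Qed.

(** The extension is an isometry because [g] is one. The product rule is tested against an arbitrary
    octonion: its component along [x] only involves the metric, its pure component is the invariance
    of [Omega]. *)
Lemma extend_automorphism g : form_stabilizer Omega g ->
  octonion_automorphism (extend_mx g).
Proof.
move=> gO; set E := extend_mx g; have xE : x *m E = x := extend_mx_unit g.
have nE u : n (u ^~P *m E) = n (u ^~P).
  by rewrite extend_mx_pure (form_stabilizer_isometry hx ho af).
have polE y z : <<y *m E, z *m E>> = <<y, z>>.
  have [c [u ->]] := pure_decomposition y; have [d [v ->]] := pure_decomposition z.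
  have xu w : <<x, w ^~P>> = 0 := adapted_perp af w.
  have xuE w : <<x, w ^~P *m E>> = 0 by rewrite extend_mx_pure.
  rewrite !mulmxDl -!scalemxAl xE !(polarDl hq, polarDr hq, polarZl hq, polarZr hq).
  rewrite !(polarC n _ x) !xu !xuE; congr (_ + (_ + _)).
  by rewrite /polar -mulmxDl -mulmxDl -linearD /= !nE.
have nE8 y : n (y *m E) = n y.
  have := polE y y; rewrite !(polar_self hq) => /mulfI; apply.
  by rewrite pnatr_eq0.
have EV : E \in unitmx.
  rewrite -row_free_unit -kermx_eq0; apply/rowV0P => w /sub_kermxP wE.
  by apply: (octonion_nondegenerate ho) => z; rewrite -polE wE (polar0l hq).
split => // v y xv; have [a aE] := adapted_span af xv.
have [c [u ->]] := pure_decomposition y.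
rewrite !(omulDr ho) !(omulZr ho) !mulmxDl -!scalemxAl !(omulDr ho) !(omulZr ho) xE.
rewrite !(omul1r ho); congr (_ + _); apply: (polar_inj ho) => z.
rewrite -[z](mulmxKV EV); have [d [w ->]] := pure_decomposition (z *m invmx E).
rewrite polE !mulmxDl -!scalemxAl xE !(polarDr hq) !(polarZr hq).
have xvE : <<x, v *m E>> = 0 by rewrite -[in X in <<X, _>>]xE polE.
congr (_ * _ + _).
  by rewrite !(omul_skewl ho)// !(omul1r ho) polE.
by rewrite aE !extend_mx_pure !(adapted_form af) gO.2.
Qed.

End Automorphisms.

(** * Monomials in a Clifford algebra *)

Section CliffordMonomials.
Context {K : numFieldType} {A : algType K} {m : nat} (c : 'I_m -> A) (q : 'I_m -> K).
Hypothesis q0 : forall i, q i != 0.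
Hypothesis csq : forall i, c i * c i = (q i)%:A.
Hypothesis canti : forall i j, i != j -> c i * c j = - (c j * c i).
Implicit Types (f h : {ffun 'I_m -> bool}) (s : seq 'I_m).

Definition partial_monomial s (f : 'I_m -> bool) : A :=
  \prod_(j <- s) (if f j then c j else 1).

(** Sets of generators are encoded by indicator functions, so that up to scalars multiplication
    becomes pointwise [addb]. *)
Definition monomial (f : 'I_m -> bool) : A := partial_monomial (enum 'I_m) f.

Definition parity (f : 'I_m -> bool) : bool := \big[addb/false]_j f j.

Lemma eq_partial_monomial s (f h : 'I_m -> bool) :
  {in s, f =1 h} -> partial_monomial s f = partial_monomial s h.
Proof. by move=> fh; apply: eq_big_seq => j /fh ->. Qed.

(** Moving [c i] to its place costs only signs; there it is inserted, or it meets its copy and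
    leaves [q i]. *)
Lemma mul_gen_partial s (f : 'I_m -> bool) i : uniq s -> i \in s ->
  exists2 k, k != 0 &
    c i * partial_monomial s f = k *: partial_monomial s (fun j => (j == i) (+) f j).
Proof.
rewrite /partial_monomial; elim: s => // j s IH /= /andP[js us].
rewrite inE !big_cons; have [ij _|ij /= is_] := eqVneq i j.
  rewrite -ij in js *.
  have -> : \prod_(j0 <- s) (if (j0 == i) (+) f j0 then c j0 else 1) =
      \prod_(j0 <- s) (if f j0 then c j0 else 1).
    by apply: eq_big_seq => l ls; case: eqP => // li; move: js; rewrite -li ls.
  case: (f i) => /=; first by exists (q i) => //; rewrite mulrA csq mul1r mulr_algl.
  by exists 1; rewrite ?oner_neq0// mul1r scale1r.
have [k k0 kE] := IH us is_.
case: (f j); last by exists k => //; rewrite !mul1r.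
exists (- k); rewrite ?oppr_eq0// mulrA canti// mulNr -mulrA kE.
by rewrite -scalerAr scaleNr.
Qed.

Lemma mul_gen_monomial f i : exists2 k, k != 0 &
  c i * monomial f = k *: monomial [ffun j => (j == i) (+) f j].
Proof.
have [k k0 kE] := mul_gen_partial f (enum_uniq 'I_m) (mem_enum _ i : i \in enum 'I_m).
exists k => //; rewrite /monomial kE; congr (_ *: _).
by apply: eq_partial_monomial => j _; rewrite ffunE.
Qed.

Lemma mul_partial_monomial s f h : uniq s -> exists2 k, k != 0 &
  partial_monomial s f * monomial h =
  k *: monomial [ffun j => ((j \in s) && f j) (+) h j].
Proof.
elim: s => [_|i s IH /= /andP[is_ us]].
  exists 1; rewrite ?oner_neq0// /partial_monomial big_nil mul1r scale1r.
  by congr monomial; apply: funext => j; rewrite ffunE.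
have [k k0 kE] := IH us; rewrite /partial_monomial big_cons -mulrA.
rewrite -/(partial_monomial s f) kE.
have E : ~~ f i -> [ffun j => ((j \in i :: s) && f j) (+) h j] =
                [ffun j => ((j \in s) && f j) (+) h j].
  move=> fi; apply/ffunP => j; rewrite !ffunE inE; case: eqP => //= ->.
  by rewrite (negPf fi) andbF.
case: ifP => fi; last by exists k => //; rewrite mul1r E ?fi.
have [k' k'0 k'E] := mul_gen_monomial [ffun j => ((j \in s) && f j) (+) h j] i.
exists (k * k'); first by rewrite mulf_neq0.
rewrite -scalerAr k'E scalerA; congr (_ *: monomial _).
apply: funext => j; rewrite !ffunE inE; case: eqP => //= ->.
by rewrite (negPf is_) fi.
Qed.

Lemma mul_monomial f h : exists2 k, k != 0 &
  monomial f * monomial h = k *: monomial [ffun j => f j (+) h j].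
Proof.
have [k k0 kE] := mul_partial_monomial f h (enum_uniq 'I_m).
exists k => //; rewrite kE; congr (_ *: monomial _).
by apply: funext => j; rewrite !ffunE mem_enum.
Qed.

Lemma monomial0 : monomial [ffun=> false] = 1.
Proof. by rewrite /monomial /partial_monomial big1// => j _; rewrite ffunE. Qed.

Lemma comm_partial_monomial s f i : c i * partial_monomial s f =
  (-1) ^+ (\big[addb/false]_(j <- s) (f j && (j != i))) *: (partial_monomial s f * c i).
Proof.
rewrite /partial_monomial; elim: s => [|j s IH].
  by rewrite !big_nil mulr1 mul1r expr0 scale1r.
rewrite !big_cons signr_addb mulrA; set P := \prod_(_ <- s) _ in IH *.
set b := \big[_/_]_(_ <- s) _ in IH *.
case: ifP => [_|fj] /=; last by rewrite mulr1 !mul1r IH.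
have [->|ji] := eqVneq j i.
  by rewrite /= expr0 mul1r -[in LHS]mulrA [in LHS]IH -scalerAr mulrA.
rewrite /= canti 1?eq_sym// mulNr -[in LHS]mulrA [in LHS]IH -scalerAr.
by rewrite expr1 mulN1r scaleNr mulrA.
Qed.

(** The generator commutes with its own copy and anticommutes with the other factors, whose number
    is odd. *)
Lemma anti_monomial f i : f i -> ~~ parity f ->
  c i * monomial f = - (monomial f * c i).
Proof.
move=> fi pf; rewrite /monomial comm_partial_monomial big_enum /=.
suff -> : \big[addb/false]_j (f j && (j != i)) = true by rewrite expr1 scaleN1r.
move: pf; rewrite /parity (bigD1 i)//= fi => pf.
by rewrite (bigD1 i)//= eqxx andbF /=; move: pf; rewrite addTb negbK => <-;
  apply: eq_bigr => j ->; rewrite andbT.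
Qed.

Lemma parity_addb f h :
  parity [ffun j => f j (+) h j] = parity f (+) parity h.
Proof. by rewrite /parity -big_split; apply: eq_bigr => j _; rewrite ffunE. Qed.

Lemma parity_flip f i : parity [ffun j => (j == i) (+) f j] = ~~ parity f.
Proof.
rewrite /parity; under eq_bigr do rewrite ffunE.
rewrite big_split /= -addTb; congr (_ (+) _).
by rewrite (bigD1 i)//= eqxx big1// => j /negPf ->.
Qed.

Lemma exists_or_false f : [exists i, f i] || (f == [ffun=> false]).
Proof.
apply/orP; have [/existsP h|/existsPn h] := boolP [exists i, f i]; first by left.
by right; apply/eqP/ffunP => i; rewrite ffunE (negPf (h i)).
Qed.

Section Representation.
Variables (d : nat) (rho : {lrmorphism A -> 'M[K]_d.+1}).

(** The monomial [X] anticommutes with a generator [C], so cyclicity gives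
    [tr(CCX) = - tr(CXC) = - tr(CCX)], where [CC] is a nonzero scalar. *)
Lemma trace_monomial f : ~~ parity f -> f != [ffun=> false] ->
  \tr (rho (monomial f)) = 0.
Proof.
move=> pf f0; have /orP[/existsP[i fi]|/eqP e] := exists_or_false f; last first.
  by rewrite e eqxx in f0.
have E := congr1 rho (anti_monomial fi pf).
have C2 : rho (c i) * rho (c i) = (q i)%:A.
  by rewrite -rmorphM csq /= linearZ /= rmorph1.
move: E; rewrite rmorphN !rmorphM; set X := rho (monomial f).
set C := rho (c i) in C2 *.
move=> E; have : q i * \tr X = - (q i * \tr X).
  transitivity (\tr (C * (C * X))); first by rewrite mulrA C2 mulr_algl mxtraceZ.
  rewrite E mulrN linearN /=; congr (- _); rewrite [LHS]mxtrace_mulC.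
  by rewrite -[_ *m C]/(X * C * C) -mulrA C2 mulr_algr mxtraceZ.
move/eqP; rewrite -addr_eq0 -mulr2n mulrn_eq0 mulf_eq0 (negPf (q0 i)) /=.
by move/eqP.
Qed.

(* The coefficients of an even element are read off from traces. *)
Definition even_section (M : 'M[K]_d.+1) : A :=
  \sum_(f : {ffun 'I_m -> bool} | ~~ parity f)
    (\tr (rho (monomial f) * M) / \tr (rho (monomial f * monomial f))) *: monomial f.

Lemma even_section_linear : linear even_section.
Proof.
move=> k M M'; rewrite /even_section scaler_sumr -big_split /=.
apply: eq_bigr => f _; rewrite mulrDr -scalerAr linearD linearZ /=.
by rewrite scalerA -scalerDl mulrDl mulrA.
Qed.

HB.instance Definition _ :=
  GRing.isLinear.Build K 'M[K]_d.+1 A _ even_section even_section_linear.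

(** Trace orthogonality: the product of two distinct even monomials is a multiple of a nonempty even
    one, of trace 0, while a square is a nonzero scalar. *)
Lemma even_section_monomial h : ~~ parity h ->
  even_section (rho (monomial h)) = monomial h.
Proof.
move=> ph; rewrite /even_section (bigD1 h)//= big1 ?addr0 => [|f /andP[pf fh]].
  rewrite -rmorphM divff ?scale1r//; have [k k0 ->] := mul_monomial h h.
  have -> : [ffun j => h j (+) h j] = [ffun=> false].
    by apply/ffunP => j; rewrite !ffunE addbb.
  by rewrite monomial0 /= linearZ /= rmorph1 mxtraceZ mxtrace1 mulf_neq0// pnatr_eq0.
have [k k0 E] := mul_monomial f h; rewrite -rmorphM E /= linearZ /= mxtraceZ.
rewrite trace_monomial ?mulr0 ?mul0r ?scale0r//.
  by rewrite parity_addb (negPf pf) (negPf ph).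
apply: contra fh => /eqP/ffunP fhE; apply/eqP/ffunP => j.
by have := fhE j; rewrite !ffunE; case: (f j) (h j) => [] [].
Qed.

Definition gen_span (b : bool) (a : A) : Prop :=
  exists k : {ffun 'I_m -> bool} -> K,
    a = \sum_(f : {ffun 'I_m -> bool} | parity f == b) k f *: monomial f.

Lemma gen_span1 : gen_span false 1.
Proof.
exists (fun f => (f == [ffun=> false])%:R).
have p0 : parity [ffun=> false] == false.
  by rewrite /parity big1// => j _; rewrite ffunE.
rewrite (bigD1 [ffun=> false])//= eqxx monomial0 scale1r big1 ?addr0//.
by move=> f /andP[_ /negPf ->]; rewrite scale0r.
Qed.

Lemma gen_spanD b a a' : gen_span b a -> gen_span b a' -> gen_span b (a + a').
Proof.
move=> [k ->] [k' ->]; exists (fun f => k f + k' f).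
by rewrite -big_split; apply: eq_bigr => f _; rewrite scalerDl.
Qed.

Lemma gen_spanZ b l a : gen_span b a -> gen_span b (l *: a).
Proof.
move=> [k ->]; exists (fun f => l * k f).
by rewrite scaler_sumr; apply: eq_bigr => f _; rewrite scalerA.
Qed.

Lemma gen_span0 b : gen_span b 0.
Proof.
by exists (fun=> 0); rewrite big1// => f _; rewrite scale0r.
Qed.

Lemma gen_span_monomial f : gen_span (parity f) (monomial f).
Proof.
exists (fun h => (h == f)%:R).
rewrite (bigD1 f)//= eqxx scale1r big1 ?addr0// => h /andP[_ /negPf ->].
by rewrite scale0r.
Qed.

Lemma gen_span_sum (I : Type) (r : seq I) (Q : pred I) (F : I -> A) b :
  (forall i, Q i -> gen_span b (F i)) -> gen_span b (\sum_(i <- r | Q i) F i).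
Proof.
move=> h; elim/big_rec: _ => [|i a Qi]; first exact: gen_span0.
by apply: gen_spanD; exact: h.
Qed.

Lemma gen_span_mul b a i : gen_span b a -> gen_span (~~ b) (c i * a).
Proof.
move=> [k ->]; rewrite mulr_sumr; apply: gen_span_sum => f /eqP <-.
rewrite -scalerAr; apply: gen_spanZ; have [l _ ->] := mul_gen_monomial f i.
by apply: gen_spanZ; rewrite -(parity_flip f i); exact: gen_span_monomial.
Qed.

Lemma even_sectionK a : gen_span false a -> even_section (rho a) = a.
Proof.
move=> [k ->]; rewrite [rho _]linear_sum linear_sum; apply: eq_bigr => f.
by rewrite eqbF_neg => pf; rewrite !linearZ /= even_section_monomial.
Qed.

End Representation.
End CliffordMonomials.

(** * Smoothness of rational maps *)

Section NearEqual.
Context {R : numFieldType} {V W : normedModType R}.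

Lemma near_eq_differentiable (f h : V -> W) (y : V) :
  (\forall z \near y, f z = h z) -> differentiable f y -> differentiable h y.
Proof.
move=> fh df; have fhy : f y = h y := nbhs_singleton fh.
have [dc /eqaddoP fE] := (diff_locallyP _ _).1 df.
have hE : h \o shift y = cst (h y) + 'd f y +o_ 0 id.
  apply/eqaddoP => e e0; have := fE e e0.
  have : \forall z \near (0 : V), f (z + y) = h (z + y).
    by move: fh; rewrite (near_shift 0) /= subr0.
  by apply: filterS2 => z fz; rewrite /= -fhy !fctE /= fz.
by apply/diff_locallyP; rewrite (diff_unique dc hE).
Qed.

End NearEqual.

Section RationalFunctions.
Context {R : realType}.

(** A syntactic class stable under directional derivatives on [O], which makes smoothness a plain
    induction. *)
Inductive ratfun p (O : set 'rV[R]_p) : ('rV[R]_p -> R) -> Prop :=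
| ratfun_cst c : ratfun O (fun=> c)
| ratfun_coord i : ratfun O (fun z => z 0 i)
| ratfunD f h : ratfun O f -> ratfun O h -> ratfun O (fun z => f z + h z)
| ratfunM f h : ratfun O f -> ratfun O h -> ratfun O (fun z => f z * h z)
| ratfunV f : ratfun O f -> (forall z, O z -> f z != 0) ->
    ratfun O (fun z => (f z)^-1).

Lemma ratfun_differentiable p (O : set 'rV[R]_p) f z :
  ratfun O f -> O z -> differentiable f z.
Proof.
move=> rf Oz; elim: rf => [c|i|h k _ dh _ dk|h k _ dh _ dk|h _ dh h0].
- exact: differentiable_cst.
- exact: differentiable_coord.
- exact: differentiableD.
- exact: differentiableM.
- by apply: differentiableV => //; exact: h0.
Qed.

Lemma ratfun_derive p (O : set 'rV[R]_p) f v : ratfun O f ->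
  exists2 h, ratfun O h & forall z, O z -> 'D_v f z = h z.
Proof.
elim=> [c|i|h k rh [h' rh' hE] rk [k' rk' kE]|h k rh [h' rh' hE] rk [k' rk' kE]
  |h rh [h' rh' hE] h0].
- by exists (fun=> 0) => [|z _]; [exact: ratfun_cst|exact: derive_cst].
- exists (fun=> v 0 i) => [|z _]; first exact: ratfun_cst.
  have := derive_mx (@derivable_id _ _ z v); rewrite derive_id => /rowP/(_ i) ->.
  by rewrite mxE.
- exists (fun z => h' z + k' z) => [|z Oz]; first exact: ratfunD.
  by rewrite -hE// -kE//; apply: deriveD; apply: diff_derivable;
    exact: ratfun_differentiable Oz.
- exists (fun z => h z * k' z + k z * h' z) => [|z Oz].
    by apply: ratfunD; apply: ratfunM.
  by rewrite -hE// -kE//; apply: deriveM; apply: diff_derivable;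
    exact: ratfun_differentiable Oz.
- exists (fun z => (-1 * ((h z)^-1 * (h z)^-1)) * h' z) => [|z Oz].
    by do !apply: ratfunM => //; [exact: ratfun_cst|exact: ratfunV|exact: ratfunV].
  rewrite -hE// deriveV ?h0//; last first.
    by apply: diff_derivable; exact: ratfun_differentiable Oz.
  by rewrite mulN1r -invfM -expr2.
Qed.

Lemma ratfun_sum p (O : set 'rV[R]_p) (I : Type) (r : seq I)
    (F : I -> 'rV[R]_p -> R) : (forall i, ratfun O (F i)) ->
  ratfun O (fun z => \sum_(i <- r) F i z).
Proof.
move=> rF; elim: r => [|i r IH].
  rewrite (_ : (fun _ => _) = fun=> 0); first exact: ratfun_cst.
  by apply/funext => z; rewrite big_nil.
rewrite (_ : (fun _ => _) = fun z => F i z + \sum_(i <- r) F i z).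
  exact: ratfunD.
by apply/funext => z; rewrite big_cons.
Qed.

Definition ratmap p q (O : set 'rV[R]_p) (F : 'rV[R]_p -> 'rV[R]_q) : Prop :=
  forall j, ratfun O (fun z => F z 0 j).

Lemma ratmap_differentiable p q (O : set 'rV[R]_p) (F : 'rV[R]_p -> 'rV[R]_q) z :
  ratmap O F -> O z -> differentiable F z.
Proof.
move=> rF Oz; have -> : F = \sum_(j < q) (fun z => F z 0 j *: delta_mx 0 j).
  by apply/funext => y; rewrite fct_sumE -row_sum_delta.
apply: differentiable_sum => j; apply: differentiableZl.
exact: ratfun_differentiable Oz.
Qed.

Lemma ratmap_derive p q (O : set 'rV[R]_p) (F : 'rV[R]_p -> 'rV[R]_q) v :
  ratmap O F -> exists2 H, ratmap O H & forall z, O z -> 'D_v F z = H z.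
Proof.
move=> rF.
have /choice[H HP] : forall j, exists h, ratfun O h /\
    forall z, O z -> 'D_v (fun z => F z 0 j) z = h z.
  by move=> j; have [h rh hE] := ratfun_derive v (rF j); exists h.
exists (fun z => \row_j H j z) => [j|z Oz].
  by rewrite (_ : (fun _ => _) = H j); [exact: (HP j).1|apply/funext => z; rewrite mxE].
rewrite derive_mx; last by apply: diff_derivable; exact: ratmap_differentiable Oz.
by apply/matrixP => i j; rewrite !mxE ord1 (HP j).2.
Qed.

Lemma ratmap_Cinfty p q (O : set 'rV[R]_p) (F : 'rV[R]_p -> 'rV[R]_q) :
  open O -> ratmap O F -> Cinfty_on O F.
Proof.
move=> oO rF vs.
(* The iterated derivatives agree with rational maps only on [O]; since [O] is open, this determines
   the next derivative there. *)
have [H rH HE] : exists2 H, ratmap O H &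
    forall z, O z -> H z = foldr (fun v G z => 'D_v G z) F vs z.
  elim: vs => [|v vs [H rH HE]]; first by exists F.
  have [H' rH' H'E] := ratmap_derive v rH; exists H' => // z Oz /=.
  rewrite -H'E//; apply: near_eq_derive; near=> y.
  by apply: HE; near: y; exact: open_nbhs_nbhs.
move=> z Oz; apply: (near_eq_differentiable (f := H)).
  by near=> y; apply: HE; near: y; exact: open_nbhs_nbhs.
exact: ratmap_differentiable Oz.
Unshelve. all: by end_near. Qed.

End RationalFunctions.

(** * Rational maps between finite dimensional spaces *)

Section RationalMaps.
Context {R : realType}.
Implicit Types U W : vectType R.

Definition preset U (O : set U) : set 'rV[R]_(\dim {:U}) := [set r | O (of_coords r)].

Definition vratfun U (O : set U) (f : U -> R) : Prop :=
  ratfun (preset O) (fun r => f (of_coords r)).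

Definition vratmap U W (O : set U) (F : U -> W) : Prop :=
  ratmap (preset O) (fun r => coords (F (of_coords r))).

Lemma of_coords_linear U : linear (@of_coords R U).
Proof. exact: passmx.vecof_linear. Qed.

Lemma coords_linear U : linear (@coords R U).
Proof. exact: passmx.rVof_linear. Qed.

Lemma coordsD U (u v : U) : coords (u + v) = coords u + coords v.
Proof. by have := coords_linear 1 u v; rewrite !scale1r. Qed.

Lemma coordsZ U a (u : U) : coords (a *: u) = a *: coords u.
Proof.
have c0 : coords 0 = 0 :> 'rV[R]_(\dim {:U}).
  by apply: (addrI (coords 0)); rewrite -coordsD !addr0.
by have := coords_linear a u 0; rewrite c0 !addr0.
Qed.

Lemma ratfun_linear p (O : set 'rV[R]_p) (f : 'rV[R]_p -> R) :
  linear_for *%R f -> ratfun O f.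
Proof.
move=> lf; have -> : f = fun z => \sum_(i < p) z 0 i * f (delta_mx 0 i).
  apply/funext => z.
  pose L := GRing.isLinear.Build _ _ R^o _ (f : 'rV[R]_p -> R^o) lf.
  pose l : {linear 'rV[R]_p -> R^o} := HB.pack (f : 'rV[R]_p -> R^o) L.
  rewrite [in LHS](row_sum_delta z) -[f]/(l : _ -> _) linear_sum /=.
  by apply: eq_bigr => i _; rewrite -[f _]/(l _) linearZ.
apply: ratfun_sum => i; apply: ratfunM; [exact: ratfun_coord|exact: ratfun_cst].
Qed.

Lemma vratfun_linear U (O : set U) (f : U -> R) : linear_for *%R f -> vratfun O f.
Proof.
move=> lf; apply: ratfun_linear => a y z.
by rewrite of_coords_linear lf.
Qed.

Lemma vratmap_linear U W (O : set U) (F : {linear U -> W}) : vratmap O F.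
Proof.
move=> j; apply: ratfun_linear => a y z.
by rewrite of_coords_linear linearP coords_linear !mxE.
Qed.

Lemma vratmap_cst U W (O : set U) (w : W) : vratmap O (fun=> w).
Proof. by move=> j; exact: ratfun_cst. Qed.

Lemma vratmapD U W (O : set U) (F H : U -> W) :
  vratmap O F -> vratmap O H -> vratmap O (fun u => F u + H u).
Proof.
move=> rF rH j; rewrite (_ : (fun _ => _) = fun r =>
  coords (F (of_coords r)) 0 j + coords (H (of_coords r)) 0 j); first exact: ratfunD.
by apply/funext => r; rewrite coordsD mxE.
Qed.

Lemma vratmapZ U W (O : set U) (f : U -> R) (F : U -> W) :
  vratfun O f -> vratmap O F -> vratmap O (fun u => f u *: F u).
Proof.
move=> rf rF j; rewrite (_ : (fun _ => _) = fun r =>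
  f (of_coords r) * coords (F (of_coords r)) 0 j); first exact: ratfunM.
by apply/funext => r; rewrite coordsZ mxE.
Qed.

Lemma vratmap_smooth U W (D O : set U) (F f : U -> W) :
  vopen O -> vratmap O F -> D `<=` O -> (forall u, D u -> f u = F u) ->
  smooth_on D f.
Proof.
move=> oO rF DO fF p Dp; exists O, F; split => //; first exact: DO.
- exact: ratmap_Cinfty.
- by move=> y Dy _; exact: fF.
Qed.

Lemma vopen_setT U : vopen (setT : set U).
Proof. exact: openT. Qed.

Lemma vopen_neq0 U (f : U -> R) : vratfun setT f -> vopen [set u | f u != 0].
Proof.
move=> rf; rewrite /vopen.
rewrite (_ : [set _ | _] = (fun r => f (of_coords r)) @^-1` [set t | t != 0])//.
apply: open_comp; last exact: open_neq.
by move=> r _; apply: differentiable_continuous; exact: ratfun_differentiable rf I.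
Qed.

End RationalMaps.

(** * The spin representation *)

Section SpinRepresentation.
Context {R : realType} (n : 'rV[R]_8 -> R) (x : 'rV[R]_8).
Context (mul : 'rV[R]_8 -> 'rV[R]_8 -> 'rV[R]_8).
Context (A : falgType R) (iota : {linear subvs_of (perp n x) -> A}).
Hypothesis hx : n x = 1.
Hypothesis ho : octonion_algebra n x mul.
Hypothesis hc : clifford_algebra (fun v => - n (vsval v)) iota.

Let hq : quadratic_form n := octonion_norm ho.
Local Notation "<< y , z >>" := (polar n y z) (at level 0).
Local Infix "**" := mul (at level 40, left associativity).
Local Notation V := (subvs_of (perp n x)).
Local Notation oact s y := (foldr mul y s).
Local Notation toV := (vsproj (perp n x)).
Local Notation pure_nonnull := (pure_nonnull n x).

Lemma perp_pure (v : V) : <<x, vsval v>> = 0.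
Proof. by apply/eqP; rewrite -mem_perp// subvsP. Qed.

Lemma toVK v : <<x, v>> = 0 -> vsval (toV v) = v.
Proof. by move=> xv; rewrite vsprojK// mem_perp// xv. Qed.

Lemma iota_sq (v : V) : iota v * iota v = (- n (vsval v))%:A.
Proof. by rewrite -expr2 (clifford_sqr hc). Qed.

Lemma iota_anti (v w : V) : <<vsval v, vsval w>> = 0 ->
  iota v * iota w = - (iota w * iota v).
Proof.
move=> vw; have := iota_sq (v + w).
rewrite !linearD /= quadD vw addr0 mulrDl !mulrDr !iota_sq opprD scalerDl.
rewrite -addrA => /addrI; rewrite addrA -[RHS]add0r => /addIr /eqP.
by rewrite addr_eq0 => /eqP.
Qed.

(** Left multiplication by [v] squares to [- n v], so the universal property applies. The transpose
    compensates for the action on rows, which reverses products. *)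
Lemma exists_spin_representation :
  exists rho : {lrmorphism A -> 'M[R]_8},
    forall v : V, rho (iota v) = (lmul_mx mul (vsval v))^T.
Proof.
pose f (v : V) : 'M[R]_8 := (lmul_mx mul (vsval v))^T.
have flin : linear f.
  move=> a v w; apply: trmx_inj; rewrite linearP /= !trmxK.
  apply/row_matrixP => i; rewrite !rowK linearP /= linearP /= !rowK.
  by rewrite (omulDl ho) (omulZl ho).
pose L := GRing.isLinear.Build _ _ _ _ f flin.
pose l : {linear V -> 'M[R]_8} := HB.pack f L.
have [v|phi phiE] := clifford_ext hc (f := l); last by exists phi.
apply: trmx_inj; rewrite expr2 [(l v * l v)^T]trmx_mul !trmxK.
apply/row_matrixP => i; rewrite !rowE mulmxA !(mul_lmul_mx ho).
by rewrite (omul_sql ho) ?perp_pure// linearZ /= [1^T]trmx1 -scalemxAr mulmx1.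
Qed.

Section Rho.
Variable rho : {lrmorphism A -> 'M[R]_8}.
Hypothesis rhoE : forall v : V, rho (iota v) = (lmul_mx mul (vsval v))^T.

Definition spin_mx (a : A) : 'M[R]_8 := (rho a)^T.

Lemma spin_mx_linear : linear spin_mx.
Proof. by move=> k a b; rewrite /spin_mx !linearP. Qed.

Lemma spin_mxM a b : spin_mx (a * b) = spin_mx b *m spin_mx a.
Proof. by rewrite /spin_mx rmorphM -trmx_mul. Qed.

Lemma spin_mx1 : spin_mx 1 = 1%:M.
Proof. by rewrite /spin_mx rmorph1 trmx1. Qed.

Lemma spin_mx_iota v y : y *m spin_mx (iota v) = vsval v ** y.
Proof. by rewrite /spin_mx rhoE trmxK (mul_lmul_mx ho). Qed.

Lemma spin_mx_prod (s : seq V) y :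
  y *m spin_mx (\prod_(v <- s) iota v) = oact (map vsval s) y.
Proof.
elim: s y => [|v s IH] y; first by rewrite big_nil spin_mx1 mulmx1.
by rewrite big_cons spin_mxM mulmxA IH spin_mx_iota.
Qed.

Lemma foldr_vsval (s : seq V) y :
  foldr (fun v => mul (vsval v)) y s = oact (map vsval s) y.
Proof. by elim: s => //= v s ->. Qed.

Lemma spin_mx_sign (b : bool) a : spin_mx ((-1) ^+ b * a) = (-1) ^+ b *: spin_mx a.
Proof.
rewrite mulr_sign scaler_sign; case: b => //.
by rewrite /spin_mx !linearN.
Qed.

Lemma spin_expr_mx g b a y : spin_expr iota g b a ->
  y *m spin_mx g = (-1) ^+ b *: oact (map vsval a) y.
Proof. by case=> _ _ ->; rewrite spin_mx_sign -scalemxAr spin_mx_prod. Qed.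

(** Every expression of [g] acts as [spin_mx g], which depends on [g] alone, so the choice made by
    [xget] is immaterial. *)
Lemma spin_actE g y : Spin iota g -> spin_act mul iota g y = y *m spin_mx g.
Proof.
move=> Gg; rewrite /spin_act; case: xgetP => [z _ [s [a [ga ->]]]|h].
  by rewrite (spin_expr_mx y ga) foldr_vsval.
by have [s [a ga]] := Gg; case: (h _ (ex_intro _ s (ex_intro _ a (conj ga erefl)))).
Qed.

Lemma spin_expr_nonnull (a : seq V) : \prod_(v <- a) n (vsval v) = 1 ->
  all pure_nonnull (map vsval a).
Proof.
move=> a1; have : \prod_(v <- a) n (vsval v) != 0 by rewrite a1 oner_neq0.
rewrite prodf_seq_neq0 => /allP h; rewrite all_map; apply/allP => v va /=.
by rewrite /pure_nonnull perp_pure eqxx; exact: h.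
Qed.

Lemma SpinM g k : Spin iota g -> Spin iota k -> Spin iota (g * k).
Proof.
move=> [s [a [ea na ->]]] [t [b [eb nb ->]]]; exists (s (+) t), (a ++ b); split.
- by rewrite size_cat oddD (negPf ea) (negPf eb).
- by rewrite big_cat /= na nb mulr1.
by rewrite big_cat /= !mulr_sign; case: s t => [] [] /=;
  rewrite ?mulrNN ?mulNr ?mulrN.
Qed.

Lemma prod_iota_rev (a : seq V) :
  (\prod_(v <- rev a) iota v) * (\prod_(v <- a) iota v) =
  (\prod_(v <- a) - n (vsval v))%:A.
Proof.
elim: a => [|v a IH]; first by rewrite !big_nil mulr1 scale1r.
rewrite rev_cons -cats1 big_cat big_seq1 !big_cons /= -mulrA [iota v * (_ * _)]mulrA.
by rewrite iota_sq mulr_algl -scalerAr IH scalerA.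
Qed.

Lemma prod_neg_even (a : seq V) : ~~ odd (size a) ->
  \prod_(v <- a) - n (vsval v) = \prod_(v <- a) n (vsval v).
Proof.
move=> ea; under eq_bigr do rewrite -mulN1r.
rewrite big_split /= big_const_seq count_predT iter_mulr_1.
by rewrite -signr_odd (negPf ea) mul1r.
Qed.

(** The inverse is the reversed word with the same sign. *)
Lemma SpinV g : Spin iota g -> exists k, [/\ Spin iota k, g * k = 1 & k * g = 1].
Proof.
move=> [s [a [ea na ->]]]; exists ((-1) ^+ s * \prod_(v <- rev a) iota v).
have sgn (b c : A) : (-1) ^+ s * b * ((-1) ^+ s * c) = b * c.
  by rewrite !mulr_sign; case: s; rewrite ?mulrNN.
split.
- exists s, (rev a); split => //; first by rewrite size_rev.
  by rewrite -[RHS]na; apply: perm_big; rewrite perm_rev.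
- rewrite sgn -{1}[a]revK prod_iota_rev prod_neg_even ?size_rev//.
  rewrite (_ : \prod_(v <- rev a) _ = 1) ?scale1r//.
  by rewrite -[RHS]na; apply: perm_big; rewrite perm_rev.
- by rewrite sgn prod_iota_rev prod_neg_even// na scale1r.
Qed.

Lemma Spin_norm g y : Spin iota g -> n (y *m spin_mx g) = n y.
Proof.
move=> [s [a ga]]; rewrite (spin_expr_mx _ ga) (quadZ hq) sqrr_sign mul1r.
by rewrite (norm_oact ho); case: ga => _ + _; rewrite big_map => ->; rewrite mul1r.
Qed.

(** For an even word, [g(vz) = s(v) g(z)] with [s] the product of its reflections; taking [z = x]
    identifies [s(v)] with [g(v)]. *)
Lemma stabilizer_automorphism g : spin_stabilizer mul iota g ->
  octonion_automorphism n x mul (spin_mx g).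
Proof.
case=> Gg; rewrite spin_actE// => gx; split => // [y|v y xv]; first exact: Spin_norm.
have [s [a ga]] := Gg; have pa : all pure_nonnull (map vsval a).
  by case: ga => _ /spin_expr_nonnull.
have mulE z : (v ** z) *m spin_mx g =
    foldr (reflection n) v (map vsval a) ** (z *m spin_mx g).
  rewrite !(spin_expr_mx _ ga) (oact_mul ho)// (omulZr ho); congr (_ *: _).
  by case: ga => ea _ _; rewrite size_map -signr_odd (negPf ea) scale1r.
have := mulE x; rewrite !(omul1r ho) gx (omul1r ho) => ->; exact: mulE.
Qed.

Section WithTriple.
Variables (eta : R) (i j l : 'rV[R]_8).
Hypothesis ct : cayley_triple n x mul eta i j l.
Hypothesis eta0 : eta != 0.
Local Notation e := (frame x mul i j l).

Lemma automorphism_stabilizer E : octonion_automorphism n x mul E ->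
  exists2 g, spin_stabilizer mul iota g & spin_mx g = E.
Proof.
move=> aE.
have [||||s [ps es ns sE]] := automorphism_oact hx ho ct eta0 (f := mulmxr E).
- by move=> c y z; rewrite linearP.
- exact: (aut_unit aE).
- by move=> y z; exact: (automorphism_polar y z aE).
- by move=> v y xv; exact: (aut_mul aE).
pose a := map toV s.
have aK : map vsval a = s.
  rewrite -map_comp map_id_in// => v /(allP ps)/andP[/eqP xv _] /=; exact: toVK.
pose g := \prod_(v <- a) iota v.
have ga : spin_expr iota g false a.
  split; rewrite ?size_map// ?expr0 ?mul1r//.
  by rewrite -(big_map vsval xpredT n) aK.
have Gg : Spin iota g by exists false, a.
have gE : spin_mx g = E.
  by apply/row_matrixP => k; rewrite !rowE (spin_expr_mx _ ga) scale1r aK -sE.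
by exists g => //; split => //; rewrite spin_actE// gE (aut_unit aE).
Qed.

Definition spin_gen (a : 'I_7) : A := iota (toV (e a)).
Definition spin_gen_sq (a : 'I_7) : R := - n (e a).

Lemma spin_gen_sq_neq0 a : spin_gen_sq a != 0.
Proof.
rewrite /spin_gen_sq oppr_eq0 (frame_normE hx ho ct)//.
exact: frame_norm_neq0.
Qed.

Lemma vsval_frame (a : 'I_7) : vsval (toV (e a)) = e a.
Proof. by apply: toVK; rewrite (frame_pure hx ho ct). Qed.

Lemma spin_gen_mul a : spin_gen a * spin_gen a = (spin_gen_sq a)%:A.
Proof. by rewrite /spin_gen iota_sq vsval_frame. Qed.

Lemma spin_gen_anti a b : a != b ->
  spin_gen a * spin_gen b = - (spin_gen b * spin_gen a).
Proof.
move=> ab; apply: iota_anti; rewrite !vsval_frame.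
rewrite (frame_gram hx ho ct (leqW (ltn_ord a)) (leqW (ltn_ord b))).
by rewrite val_eqE (negPf ab).
Qed.

Lemma prod_iota_span (s : seq V) :
  gen_span spin_gen (odd (size s)) (\prod_(v <- s) iota v).
Proof.
elim: s => [|v s IH]; first by rewrite big_nil; exact: gen_span1.
rewrite big_cons /=; have [U UE] := frame_comb_surj hx ho ct eta0 (perp_pure v).
have -> : iota v = \sum_(a < 7) U a *: spin_gen a.
  have -> : v = \sum_(a < 7) U a *: toV (e a).
    apply: val_inj; rewrite [LHS]UE linear_sum; apply: eq_bigr => a _.
    by rewrite linearZ /= vsval_frame.
  by rewrite linear_sum; apply: eq_bigr => a _; rewrite linearZ.
rewrite mulr_suml; apply: gen_span_sum => a _; rewrite -scalerAl; apply: gen_spanZ.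
exact: (gen_span_mul spin_gen_sq_neq0 spin_gen_mul spin_gen_anti _ IH).
Qed.

(** A linear map recovering a spin element from its matrix; it makes the inverse isomorphism
    smooth. *)
Definition spin_section (E : 'M[R]_8) : A := even_section spin_gen rho E^T.

Lemma spin_section_linear : linear spin_section.
Proof. by move=> k E F; rewrite /spin_section linearP; exact: even_section_linear. Qed.

Lemma spin_sectionK g : Spin iota g -> spin_section (spin_mx g) = g.
Proof.
move=> [s [a [ea _ ->]]]; rewrite /spin_section /spin_mx trmxK.
apply: (even_sectionK spin_gen_sq_neq0 spin_gen_mul spin_gen_anti).
have := prod_iota_span a; rewrite (negPf ea) => h.
by rewrite mulr_sign; case: s => //; rewrite -scaleN1r; exact: gen_spanZ.
Qed.

End WithTriple.
End Rho.
End SpinRepresentation.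

(** * The stabilizer of the unit spinor as a Lie group *)

Section StabilizerIsomorphism.
Context {R : realType} (n : 'rV[R]_8 -> R) (x : 'rV[R]_8).
Context (mul : 'rV[R]_8 -> 'rV[R]_8 -> 'rV[R]_8).
Context (A : falgType R) (iota : {linear subvs_of (perp n x) -> A}).
Hypothesis hx : n x = 1.
Hypothesis ho : octonion_algebra n x mul.
Hypothesis hc : clifford_algebra (fun v => - n (vsval v)) iota.
Variable rho : {lrmorphism A -> 'M[R]_8}.
Hypothesis rhoE : forall v : subvs_of (perp n x),
  rho (iota v) = (lmul_mx mul (vsval v))^T.
Variables (eta : R) (i j l : 'rV[R]_8).
Hypothesis ct : cayley_triple n x mul eta i j l.
Hypothesis eta0 : eta != 0.

Let hq : quadratic_form n := octonion_norm ho.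
Local Notation "<< y , z >>" := (polar n y z) (at level 0).
Local Infix "**" := mul (at level 40, left associativity).
Local Notation e := (frame x mul i j l).
Local Notation G := (Spin iota).
Local Notation stab := (spin_stabilizer mul iota).
Local Notation toV := (vsproj (perp n x)).
Local Notation act := (spin_act mul iota).

Lemma vratmap_of_linear (U W : vectType R) (O : set U) (F : U -> W) :
  linear F -> vratmap O F.
Proof.
move=> lF; pose L := GRing.isLinear.Build _ _ _ _ F lF.
pose f : {linear U -> W} := HB.pack F L.
exact: (vratmap_linear O f).
Qed.

Lemma linear_smooth (U W : vectType R) (D : set U) (F f : U -> W) :
  linear F -> (forall u, D u -> f u = F u) -> smooth_on D f.
Proof.
move=> lF; apply: (vratmap_smooth (O := setT)) => //; first exact: vopen_setT.
exact: vratmap_of_linear.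
Qed.

Section WithForm.
Variables (Omega : 'cV[R]_7 -> 'cV[R]_7 -> 'cV[R]_7 -> R) (P : 'M[R]_(7, 8)).
Hypothesis af : adapted_frame n x mul Omega P.

Let spin_aut g : stab g -> octonion_automorphism n x mul (spin_mx rho g) :=
  stabilizer_automorphism ho rhoE (g := g).

Lemma stabilizer_lie_group_iso : lie_group_iso stab (form_stabilizer Omega).
Proof.
pose sec := spin_section mul iota rho i j l.
have secK g : G g -> sec (spin_mx rho g) = g.
  exact: (spin_sectionK hx ho hc rho ct eta0).
pose f g : 'M[R]_7 := restrict_mx x P (spin_mx rho g).
pose h M : A := sec (extend_mx x P M).
have hf g : stab g -> h (f g) = g.
  by move=> sg; rewrite /h /f (restrict_mxK hx ho af (spin_aut sg)) secK//; case: sg.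
exists f, h; split => //.
- split=> [g sg|g k /set_mem sg /set_mem sk fgk|M gM].
  + exact: (restrict_form_stabilizer hx ho af (spin_aut sg)).
  + by rewrite -(hf _ sg) -(hf _ sk) fgk.
  + have [g sg gE] := automorphism_stabilizer hx ho rhoE ct eta0
      (extend_automorphism hx ho af gM).
    by exists g => //; rewrite /f gE (extend_mxK hx ho af).
(* Both [spin_mx] and [restrict_mx] reverse products, so [f] preserves them. *)
- by move=> a b sa sb; rewrite /f spin_mxM (restrict_mxM hx ho af _ (spin_aut sb)).
- apply: (linear_smooth (F := f)) => // c a b.
  rewrite /f spin_mx_linear /restrict_mx mulmxDr mulmxDl -scalemxAr -scalemxAl.
  by rewrite linearP.
(* The extension of [M] splits into a constant block fixing [x] and a block linear in [M], so [h] is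
   affine. *)
- pose Q := full_frame x P.
  pose E0 : 'M[R]_8 := invmx Q *m (block_mx 1%:M 0 0 0 : 'M[R]_(1 + 7)) *m Q.
  pose E1 (M : 'M[R]_7) : 'M[R]_8 :=
    invmx Q *m (block_mx 0 0 0 M^T : 'M[R]_(1 + 7)) *m Q.
  have secl := spin_section_linear mul iota rho i j l.
  have hE M : h M = sec E0 + sec (E1 M).
    rewrite -[sec E0]scale1r -secl scale1r; congr sec.
    by rewrite -mulmxDl -mulmxDr add_block_mx !addr0 add0r.
  apply: (vratmap_smooth (O := setT) (F := fun M => sec E0 + sec (E1 M))) => //.
    exact: vopen_setT.
  apply: vratmapD; first exact: vratmap_cst.
  apply: vratmap_of_linear => c M M'; rewrite -secl; congr sec.
  rewrite /E1 scalemxAl -mulmxDl scalemxAr -mulmxDr scale_block_mx add_block_mx.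
  by rewrite !scaler0 !addr0 linearP.
Qed.

End WithForm.

(** * The orbit of the unit spinor and local sections *)

Section Orbit.
(** With equal norms, [n(section_vector)] is a nonzero multiple of a sum of two squares, hence
    nonzero once [(e_a, q)] is, in the split case too. *)
Lemma partner_index a : (a < 7)%N ->
  exists b, [/\ (b < 7)%N, a != b & frame_norm eta a = frame_norm eta b].
Proof.
case: a => [|[|[|[|[|[|[|//]]]]]]] _;
  [exists 1|exists 0|exists 0|exists 4|exists 3|exists 3|exists 3]; by split.
Qed.

Definition section_vector a b (q : 'rV[R]_8) : 'rV[R]_8 :=
  <<e a, q>> *: e b - <<e b, q>> *: e a.

(* w = section_vector a b q is purely imaginary and orthogonal to q, so that
   w ** q is purely imaginary and w ** (w ** q) = - n w *: q. *)
Definition sphere_section a b (k : A) (K : 'M[R]_8) (q : 'rV[R]_8) : A :=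
  let w := section_vector a b (q *m K) in
  - (n w)^-1 *: (k * (iota (toV w) * iota (toV (w ** (q *m K))))).

Lemma section_vector_norm a b q : (a < 7)%N -> (b < 7)%N -> a != b ->
  frame_norm eta a = frame_norm eta b ->
  n (section_vector a b q) = frame_norm eta a * (<<e a, q>> ^+ 2 + <<e b, q>> ^+ 2).
Proof.
move=> a7 b7 /negPf ab nab; rewrite /section_vector (quadD n) (quadN hq).
rewrite (polarNr hq) (polarZl hq) (polarZr hq) !(quadZ hq).
rewrite !(frame_normE hx ho ct)// (frame_gram hx ho ct) 1?leqW// eq_sym ab nab; ring.
Qed.

(** The two vectors are scaled to have norms of product 1. Applied to [x], they give
    [- n(w)^-1 w(w(qK)) = qK], and [k] undoes [K]. *)
Lemma sphere_section_correct a b k K q : (a < 7)%N -> (b < 7)%N -> a != b ->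
  frame_norm eta a = frame_norm eta b -> G k ->
  K *m spin_mx rho k = 1%:M -> (forall y, n (y *m K) = n y) ->
  n q = 1 -> n (section_vector a b (q *m K)) != 0 ->
  G (sphere_section a b k K q) /\ x *m spin_mx rho (sphere_section a b k K q) = q.
Proof.
move=> a7 b7 ab nab Gk Kk nK nq; set q' := q *m K.
set w := section_vector a b q' => w0.
have xw : <<x, w>> = 0.
  by rewrite (polarBr hq) !(polarZr hq) !(frame_pure hx ho ct)// !mulr0 subr0.
have wq : <<w, q'>> = 0.
  by rewrite (polarBl hq) !(polarZl hq) mulrC subrr.
have xwq : <<x, w ** q'>> = 0 by rewrite (polar_omul_unit ho)// wq oppr0.
have sE : sphere_section a b k K q =
    k * (iota (toV w) * iota (toV (- (n w)^-1 *: (w ** q')))).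
  by rewrite /sphere_section -/q' -/w !linearZ /= -!scalerAr.
have Gw : G (iota (toV w) * iota (toV (- (n w)^-1 *: (w ** q')))).
  exists false, [:: toV w; toV (- (n w)^-1 *: (w ** q'))]; split => //=.
  - rewrite !big_cons big_nil mulr1 !(toVK ho)//; last first.
      by rewrite (polarZr hq) xwq mulr0.
    rewrite (quadZ hq) (onormM ho) nK nq.
    by field.
  - by rewrite expr0 mul1r !big_cons big_nil mulr1.
split; first by rewrite sE; exact: SpinM.
rewrite sE !spin_mxM !mulmxA !(spin_mx_iota ho rhoE) (omul1r ho).
rewrite !(toVK ho)//; last first.
  by rewrite (polarZr hq) xwq mulr0.
rewrite (omulZr ho) (omul_sql ho)// scalerA mulrNN mulVf// scale1r.
by rewrite -mulmxA Kk mulmx1.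
Qed.

(** As [w] is linear in [q], expanding it along [e_a] and [e_b] leaves linear maps [L c d] with
    rational coefficients of denominator [n(w)]. *)
Lemma sphere_section_smooth a b k K D :
  D `<=` [set q | n (section_vector a b (q *m K)) != 0] ->
  vopen [set q | n (section_vector a b (q *m K)) != 0] /\
  smooth_on D (sphere_section a b k K).
Proof.
set O := [set q | _] => DO.
have rc c O' : vratfun O' (fun q => <<e c, q *m K>>).
  apply: vratfun_linear => t y z.
  by rewrite mulmxDl -scalemxAl (polarDr hq) (polarZr hq).
have rn O' : vratfun O' (fun q => n (section_vector a b (q *m K))).
  pose al q := <<e a, q *m K>>; pose be q := <<e b, q *m K>>.
  rewrite (_ : (fun _ => _) = fun q => al q * (al q * n (e b)) +
     (be q * (be q * n (e a)) + -1 * (al q * (be q * <<e b, e a>>)))); last first.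
    apply/funext => q; rewrite /section_vector (quadD n) (quadN hq) (polarNr hq).
    by rewrite (polarZl hq) (polarZr hq) !(quadZ hq) /al /be; ring.
  apply: ratfunD; first by do 2![apply: ratfunM; first exact: rc]; exact: ratfun_cst.
  apply: ratfunD; first by do 2![apply: ratfunM; first exact: rc]; exact: ratfun_cst.
  apply: ratfunM; first exact: ratfun_cst.
  by do 2![apply: ratfunM; first exact: rc]; exact: ratfun_cst.
have oO : vopen O by exact: vopen_neq0.
split => //.
pose L c d (q : 'rV[R]_8) : A := k * (iota (toV (e c)) * iota (toV (e d ** (q *m K)))).
have rL c d : vratmap O (L c d).
  apply: vratmap_of_linear => t y z.
  by rewrite /L mulmxDl -scalemxAl (omulDr ho) (omulZr ho) !linearP /= mulrDr mulrDr
    -!scalerAr.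
pose al q := <<e a, q *m K>>; pose be q := <<e b, q *m K>>.
pose F q : A := (-1 * (n (section_vector a b (q *m K)))^-1) *:
  (al q *: (al q *: L b b q + (-1 * be q) *: L b a q) +
   (-1 * be q) *: (al q *: L a b q + (-1 * be q) *: L a a q)).
apply: (vratmap_smooth (O := O) (F := F)) => //.
  have rm O' : vratfun O' (fun q => -1 * be q).
    by apply: ratfunM; [exact: ratfun_cst|exact: rc].
  have ra O' : vratfun O' al by exact: rc.
  apply: vratmapZ.
    apply: ratfunM; first exact: ratfun_cst.
    by apply: ratfunV; first exact: rn.
  by do !(apply: vratmapD || apply: vratmapZ) => //.
move=> q _; rewrite /sphere_section /F mulN1r; congr (_ *: _).
rewrite /section_vector -/(al q) -/(be q) /L.
rewrite (omulDl ho) (omulNl ho) !(omulZl ho) !linearB !linearZ /=.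
rewrite !scalerN -!scaleNr !mulN1r mulrDl !mulrDr.
by do 3![rewrite -?scalerAl -?scalerAr]; rewrite !scalerDr !addrA.
Qed.

Lemma sphere_local_section p : n p = 1 ->
  exists (O : set 'rV[R]_8) (sigma : 'rV[R]_8 -> A),
    [/\ vopen O, O p,
      forall q, n q = 1 -> O q -> G (sigma q) /\ x *m spin_mx rho (sigma q) = q
      & smooth_on ([set q | n q = 1] `&` O) sigma].
Proof.
move=> np.
suff [k [K [a [Gk Kk nK a7 pa]]]] : exists k K a, [/\ G k, K *m spin_mx rho k = 1%:M,
    forall y, n (y *m K) = n y, (a < 7)%N & <<e a, p *m K>> != 0].
  have [b [b7 ab nab]] := partner_index a7.
  pose B : set 'rV[R]_8 := [set q | n (section_vector a b (q *m K)) != 0].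
  have [oB sm] := @sphere_section_smooth a b k K ([set q | n q = 1] `&` B)
    (fun q h => h.2).
  exists B, (sphere_section a b k K); split => //.
    rewrite /B /= section_vector_norm// mulf_neq0 ?frame_norm_neq0// gt_eqF//.
    by rewrite ltr_wpDr ?sqr_ge0// lt_def sqrf_eq0 pa sqr_ge0.
  by move=> q nq Bq; exact: sphere_section_correct.
have [[a [a7 pa]]|h] := pselect (exists a, (a < 7)%N /\ <<e a, p>> != 0).
  exists 1, 1%:M, a; split; rewrite ?spin_mx1 ?mulmx1//.
    by exists false, [::]; split; rewrite ?big_nil ?expr0 ?mulr1.
  by move=> y; rewrite mulmx1.
(* All pure coordinates of [p] vanish, so [p] is a multiple of [x] and must first be moved. *)
have pE : p = (<<p, x>> / 2) *: x.
  apply: (frame_ext hx ho ct eta0) => [|a a7].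
    by rewrite (polarZl hq) (polar_self hq) hx mulr1 divfK// pnatr_eq0.
  rewrite (polarZl hq) (frame_pure hx ho ct)// mulr0 polarC.
  by apply: contrapT => pa; apply: h; exists a; split => //; apply/eqP.
set c := _ / 2 in pE.
have Gij : G (iota (toV (e 0)) * iota (toV (e 1))).
  exists false, [:: toV (e 0); toV (e 1)]; split => //=.
    rewrite !big_cons big_nil !(toVK ho) ?(frame_pure hx ho ct)//.
    by rewrite !(frame_normE hx ho ct)// /frame_norm /= !mulr1.
  by rewrite expr0 mul1r !big_cons big_nil mulr1.
have [k [Gk _ kg]] := SpinV hc Gij.
set g := iota _ * iota _ in Gij kg.
(* The element [g] sends [x] to [e_0 e_1 = e_2], hence the index 2; [k] is its inverse. *)
exists k, (spin_mx rho g), 2%N; split => //.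
- by rewrite -spin_mxM kg spin_mx1.
- by move=> y; exact: (Spin_norm ho rhoE).
rewrite pE -scalemxAl (polarZr hq) mulf_neq0//.
  apply/eqP => c0; move: np; rewrite pE c0 scale0r (quad0 hq) => /eqP.
  by rewrite eq_sym oner_eq0.
rewrite /g spin_mxM mulmxA !(spin_mx_iota ho rhoE) !(toVK ho) ?(frame_pure hx ho ct)//.
rewrite (omul1r ho) (frame_mul ho ct)// (polarZr hq) /frame_table /= mul1r.
by rewrite (frame_gram hx ho ct)// /frame_norm /= mulr1 pnatr_eq0.
Qed.

(** The map is [gH -> gx]. Injectivity comes from inverses in the spin group, surjectivity and the
    local lifts from the local sections, and smoothness from linearity in [g]. *)
Lemma spin_homogeneous_diffeo :
  homogeneous_diffeo act G stab (unit_sphere n).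
Proof.
have G1 : G 1 by exists false, [::]; split; rewrite ?big_nil ?expr0 ?mulr1.
have stab1 : stab 1 by split => //; rewrite (spin_actE ho rhoE) ?spin_mx1 ?mulmx1.
pose Phi (X : set A) : 'rV[R]_8 := act (xget 0 X) x.
have PhiE g : G g -> Phi (lcoset_of g stab) = x *m spin_mx rho g.
  move=> Gg; rewrite /Phi; case: xgetP => [y _ [h [Gh hh] <-]|nh]; last first.
    by case: (nh (g * 1)); exists 1.
  have Ggh := SpinM Gg Gh; rewrite (spin_actE ho rhoE)// spin_mxM mulmxA.
  by move: hh; rewrite (spin_actE ho rhoE)// => ->.
have loc := sphere_local_section.
exists Phi; split.
- split=> [_ [g Gg <-]|X Y|p np].
  + by rewrite /unit_sphere /= PhiE// (Spin_norm ho rhoE).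
  + move=> /set_mem[g Gg <-] /set_mem[k Gk <-]; rewrite !PhiE// => gk.
    have [g' [Gg' gg' g'g]] := SpinV hc Gg; have [k' [Gk' kk' k'k]] := SpinV hc Gk.
    have stM a b : stab a -> stab b -> stab (a * b).
      move=> [Ga ha] [Gb hb]; have Gab := SpinM Ga Gb; split => //.
      move: ha hb; rewrite !(spin_actE ho rhoE)// spin_mxM mulmxA => ha ->.
      exact: ha.
    have st a b a' : G b -> G a' -> a' * a = 1 ->
        x *m spin_mx rho a = x *m spin_mx rho b -> stab (a' * b).
      move=> Gb Ga' a'a ab; have Gab := SpinM Ga' Gb.
      split => //; rewrite (spin_actE ho rhoE)// spin_mxM mulmxA -ab -mulmxA.
      by rewrite -spin_mxM a'a spin_mx1 mulmx1.
    have sub a b b' : G a -> G b' -> b * b' = 1 -> b' * b = 1 ->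
        x *m spin_mx rho a = x *m spin_mx rho b ->
        lcoset_of a stab `<=` lcoset_of b stab.
      move=> Ga Gb' bb' b'b ab _ [h sh <-]; exists (b' * a * h).
        by apply: stM => //; apply: (st b).
      by rewrite -[b' * a * h]mulrA mulrA bb' mul1r.
    by apply/seteqP; split; [apply: (sub g k k')|apply: (sub k g g')].
  + have [B [sigma [_ Bp sE _]]] := loc p np; have [Gs xs] := sE p np Bp.
    by exists (lcoset_of (sigma p) stab); [exists (sigma p)|rewrite PhiE].
- move=> g k Gg Gk; rewrite !PhiE//; last exact: SpinM.
  by rewrite (spin_actE ho rhoE)// spin_mxM mulmxA.
- apply: (linear_smooth (F := fun g => x *m spin_mx rho g)) => //.
  by move=> c a b; rewrite spin_mx_linear mulmxDr -scalemxAr.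
move=> p np; have [B [sigma [oB Bp sE sm]]] := loc p np; exists B, sigma; split => //.
by move=> q nq Bq; have [Gs xs] := sE q nq Bq; split => //; rewrite PhiE.
Qed.

End Orbit.
End StabilizerIsomorphism.

(** * The definite and the split case *)

Theorem corollary6p3 (R : realType) (n : 'rV[R]_8 -> R) (x : 'rV[R]_8)
    (mul : 'rV[R]_8 -> 'rV[R]_8 -> 'rV[R]_8)
    (A : falgType R) (iota : {linear subvs_of (perp n x) -> A}) :
  n x = 1 ->
  octonion_algebra n x mul ->
  clifford_algebra (fun v => - n (vsval v)) iota ->
  let stab := spin_stabilizer mul iota in
  (positive_definite n ->
     lie_group_iso stab (@G2_compact R) /\
     homogeneous_diffeo (spin_act mul iota) (Spin iota) stab (unit_sphere n)) /\
  (signature44 n ->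
     lie_group_iso stab (@G2_split R) /\
     homogeneous_diffeo (spin_act mul iota) (Spin iota) stab (unit_sphere n)).
Proof.
move=> hx ho hc stab; have [rho rhoE] := exists_spin_representation ho hc.
split=> hn.
- have [i [j [l ct]]] := cayley_triple_definite ho hn.
  have [P af] := adapted_frame_definite hx ho hn.
  have eta0 := oner_neq0 R; split.
    exact: (stabilizer_lie_group_iso hx ho hc rhoE ct eta0 af).
  exact: (spin_homogeneous_diffeo hx ho hc rhoE ct eta0).
- have [i [j [l ct]]] := cayley_triple_split hx ho hn.
  have [P af] := adapted_frame_split hx ho hn.
  have eta0 : -1 != 0 :> R by rewrite oppr_eq0 oner_neq0.
  split; first exact: (stabilizer_lie_group_iso hx ho hc rhoE ct eta0 af).
  exact: (spin_homogeneous_diffeo hx ho hc rhoE ct eta0).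
Qed.
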